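(* Let $f(x)=\frac12(\sqrt x-1)^2$ (squared Hellinger distance). There exists an FPRAS for approximating $D_f(\nu\|\mu)$ between the Gibbs distributions $\nu,\mu$ of two Ising models $(G,J^\nu,h^\nu)$ and $(G,J^\mu,h^\mu)$, provided that $\nu$ and $\mu$ are both $b$-marginally bounded for a constant $b>0$, at least one of the two input Ising models admits a polynomial time sampling oracle, and the two input Ising models together with the averaged Ising model $(G,J^{\mathsf{avg}},h^{\mathsf{avg}})$, where $J^{\mathsf{avg}}=\frac12(J^\nu+J^\mu)$ and $h^{\mathsf{avg}}=\frac12(h^\nu+h^\mu)$, all admit polynomial time approximate counting oracles.
   Context: An Ising model $(G,J,h)$ on $G=(V,E)$, $n=|V|$, consists of a symmetric $J\in\mathbb{R}^{V\times V}$ with $J_{uv}\ne0$ only if $\{u,v\}\in E$, and $h\in\mathbb{R}^V$; its Gibbs distribution on $\Omega=\{-1,+1\}^V$ is $\mu(\sigma)=w_\mu(\sigma)/Z_\mu$ with $w_\mu(\sigma)=\exp(\tfrac12\sigma^TJ\sigma+h^T\sigma)$, $Z_\mu=\sum_\sigma w_\mu(\sigma)$. $D_f(\nu\|\mu)=\sum_{\sigma\in\Omega}\mu(\sigma)f(\nu(\sigma)/\mu(\sigma))$. $\mu$ is $b$-marginally bounded if for every $\Lambda\subseteq V$, pinning $\sigma\in\{-1,+1\}^\Lambda$, $v\notin\Lambda$, $c\in\{-1,+1\}$, the conditional marginal probability that $v$ takes value $c$ given $\sigma$ on $\Lambda$ is at least $b$. A polynomial time sampling oracle returns, given $\varepsilon>0$,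 in time $\mathrm{poly}(n/\varepsilon)$ a random configuration whose law is within total variation distance $\varepsilon$ of the Gibbs distribution; a polynomial time approximate counting oracle returns, given $\varepsilon>0$, in time $\mathrm{poly}(n/\varepsilon)$ a number $\hat Z$ with $\Pr[\mathrm{e}^{-\varepsilon}Z\le\hat Z\le\mathrm{e}^\varepsilon Z]\ge0.99$ for the partition function $Z$. An FPRAS runs in time polynomial in $n$ and $1/\varepsilon$ and with probability at least $2/3$ outputs $\hat D$ with $\mathrm{e}^{-\varepsilon}D_f(\nu\|\mu)\le\hat D\le\mathrm{e}^\varepsilon D_f(\nu\|\mu)$. *)

(* Defs.v *)
From Stdlib Require Import Reals List Arith Bool.
Import ListNotations.
Open Scope R_scope.

Fixpoint rsum (n : nat) (f : nat -> R) : R :=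
  match n with 0%nat => 0 | S m => rsum m f + f m end.

Definition lsum {A} (l : list A) (f : A -> R) : R :=
  fold_right Rplus 0 (map f l).

(* all configurations in {-1,+1}^n, encoded as lists of booleans of
   length n (true = +1, false = -1) *)
Fixpoint all_configs (n : nat) : list (list bool) :=
  match n with
  | 0%nat => [[]]
  | S m => map (cons true) (all_configs m) ++ map (cons false) (all_configs m)
  end.

Definition spin (b : bool) : R := if b then 1 else -1.
Definition sp (s : list bool) (u : nat) : R := spin (nth u s false).

Definition energy (n : nat) (J : nat -> nat -> R) (h : nat -> R) (s : list bool) : R :=
  / 2 * rsum n (fun u => rsum n (fun v => J u v * sp s u * sp s v))
  + rsum n (fun u => h u * sp s u).

Definition gweight n J h s : R := exp (energy n J h s).
Definition partition n J h : R := lsum (all_configs n) (gweight n J h).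
Definition gibbs n J h s : R := gweight n J h s / partition n J h.

Definition hell_f (x : R) : R := / 2 * (sqrt x - 1) ^ 2.
Definition f_div (f : R -> R) (nu mu : list bool -> R) (n : nat) : R :=
  lsum (all_configs n) (fun s => mu s * f (nu s / mu s)).

(* pinning tau : partial assignment on Lambda = {u < n | tau u <> None} *)
Definition compatb (n : nat) (tau : nat -> option bool) (s : list bool) : bool :=
  forallb (fun u => match tau u with
                    | None => true
                    | Some c => Bool.eqb (nth u s false) c end) (seq 0 n).

Definition cond_marginal n J h (tau : nat -> option bool) (v : nat) (c : bool) : R :=
  lsum (all_configs n)
       (fun s => if compatb n tau s && Bool.eqb (nth v s false) c
                 then gibbs n J h s else 0)
  / lsum (all_configs n) (fun s => if compatb n tau s then gibbs n J h s else 0).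

Definition marginally_bounded n J h (b : R) : Prop :=
  forall (tau : nat -> option bool) (v : nat) (c : bool),
    (v < n)%nat -> tau v = None -> b <= cond_marginal n J h tau v c.

Record instance := {
  inst_n : nat;
  inst_edge : nat -> nat -> bool;
  J_nu : nat -> nat -> R; h_nu : nat -> R;
  J_mu : nat -> nat -> R; h_mu : nat -> R;
  inst_flag : bool  (* true: sampling oracle is for nu; false: for mu *)
}.

Definition ising_params_ok (n : nat) (E : nat -> nat -> bool) (J : nat -> nat -> R) : Prop :=
  forall u v, (u < n)%nat -> (v < n)%nat ->
    J u v = J v u /\ (J u v <> 0 -> E u v = true).

Definition valid_instance (I : instance) : Prop :=
  (forall u v, (u < inst_n I)%nat -> (v < inst_n I)%nat ->
      inst_edge I u v = inst_edge I v u /\ inst_edge I u u = false)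
  /\ ising_params_ok (inst_n I) (inst_edge I) (J_nu I)
  /\ ising_params_ok (inst_n I) (inst_edge I) (J_mu I).

Inductive model_id := MNu | MMu | MAvg.

Definition J_of (I : instance) (m : model_id) : nat -> nat -> R :=
  match m with
  | MNu => J_nu I | MMu => J_mu I
  | MAvg => fun u v => / 2 * (J_nu I u v + J_mu I u v) end.
Definition h_of (I : instance) (m : model_id) : nat -> R :=
  match m with
  | MNu => h_nu I | MMu => h_mu I
  | MAvg => fun u => / 2 * (h_nu I u + h_mu I u) end.

Definition gibbs_of I m := gibbs (inst_n I) (J_of I m) (h_of I m).
Definition Z_of I m := partition (inst_n I) (J_of I m) (h_of I m).

Definition hellinger_target (I : instance) : R :=
  f_div hell_f (gibbs_of I MNu) (gibbs_of I MMu) (inst_n I).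

Definition dist (A : Type) := list (R * A).

Definition is_dist {A} (d : dist A) : Prop :=
  Forall (fun pa => 0 <= fst pa) d /\ lsum d fst = 1.

Definition dbind {A B} (d : dist A) (f : A -> dist B) : dist B :=
  flat_map (fun pa => map (fun qb => (fst pa * fst qb, snd qb)) (f (snd pa))) d.

Definition prob {A} (d : dist A) (P : A -> bool) : R :=
  lsum d (fun pa => if P (snd pa) then fst pa else 0).

Definition mass (d : dist (list bool)) (s : list bool) : R :=
  prob d (fun t => if list_eq_dec bool_dec t s then true else false).

Definition tv_to_gibbs (n : nat) (d : dist (list bool)) (g : list bool -> R) : R :=
  / 2 * lsum (all_configs n) (fun s => Rabs (mass d s - g s)).

Definition Rleb (x y : R) : bool := if Rle_dec x y then true else false.

Record oracles := {
  samp : R -> dist (list bool);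
  samp_cost : R -> nat;
  cnt : model_id -> R -> dist R;
  cnt_cost : model_id -> R -> nat
}.

Definition poly_time (n : nat) (C : R) (k : nat) (eps : R) : R :=
  C * (INR n + / eps + 1) ^ k.

Definition oracles_ok (I : instance) (C : R) (k : nat) (o : oracles) : Prop :=
  let n := inst_n I in
  (forall eps, 0 < eps ->
     let m := if inst_flag I then MNu else MMu in
     is_dist (samp o eps)
     /\ Forall (fun pa => length (snd pa) = n) (samp o eps)
     /\ tv_to_gibbs n (samp o eps) (gibbs_of I m) <= eps
     /\ INR (samp_cost o eps) <= poly_time n C k eps)
  /\
  (forall m eps, 0 < eps ->
     is_dist (cnt o m eps)
     /\ prob (cnt o m eps)
          (fun z => Rleb (exp (- eps) * Z_of I m) z && Rleb z (exp eps * Z_of I m))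
        >= 99 / 100
     /\ INR (cnt_cost o m eps) <= poly_time n C k eps).

Inductive instr :=
| IHalt (o : nat)
| IJmp (l : nat)
| IJltR (a b l : nat)
| IJltN (a b l : nat)
| IRofN (d a : nat)
| IRAdd (d a b : nat) | IRSub (d a b : nat) | IRMul (d a b : nat) | IRDiv (d a b : nat)
| IRExp (d a : nat) | IRLn (d a : nat) | IRSqrt (d a : nat)
| IRLoad (d a : nat)
| IRStore (a s : nat)
| INConst (d k : nat)
| INAdd (d a b : nat) | INSub (d a b : nat) | INMul (d a b : nat)
| INLoad (d a : nat)
| INStore (a s : nat)
| IReadN (d : nat)
| IReadFlag (d : nat)
| IReadEdge (d u v : nat)
| IReadJ (m : bool) (d u v : nat)
| IReadH (m : bool) (d u : nat)
| IFlip (d : nat)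
| ISample (a e : nat)
| ICount (m : model_id) (d e : nat).

Inductive outcome := Halted (r : R) | Failed | Timeout.

Definition updR (f : nat -> R) (d : nat) (x : R) : nat -> R :=
  fun i => if Nat.eqb i d then x else f i.
Definition updN (f : nat -> nat) (d : nat) (x : nat) : nat -> nat :=
  fun i => if Nat.eqb i d then x else f i.
Definition write_cfg (rr : nat -> R) (base : nat) (s : list bool) : nat -> R :=
  fun i => if Nat.leb base i && Nat.ltb i (base + length s)
           then spin (nth (i - base) s false) else rr i.

(* cost of an instruction; natural-number arithmetic is charged by bit length,
   real arithmetic is unit cost (real-RAM), oracle calls cost their running time *)
Definition icost (o : oracles) (ins : instr) (rr : nat -> R) (nr : nat -> nat) : nat :=
  match ins with
  | INAdd _ a b | INSub _ a b | INMul _ a b | IJltN a b _ => S (Nat.log2 (nr a + nr b))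
  | ISample _ e => S (samp_cost o (rr e))
  | ICount m _ e => S (cnt_cost o m (rr e))
  | _ => 1%nat
  end.

Fixpoint exec (P : list instr) (I : instance) (o : oracles) (fuel budget : nat)
         (pc : nat) (rr : nat -> R) (nr : nat -> nat) {struct fuel} : dist outcome :=
  match fuel with
  | 0%nat => [(1, Timeout)]
  | S f =>
    match nth_error P pc with
    | None => [(1, Failed)]
    | Some ins =>
      let c := icost o ins rr nr in
      if Nat.ltb budget c then [(1, Timeout)] else
      let bud := (budget - c)%nat in
      let nx := S pc in
      match ins with
      | IHalt r => [(1, Halted (rr r))]
      | IJmp l => exec P I o f bud l rr nr
      | IJltR a b l =>
          if Rlt_dec (rr a) (rr b) then exec P I o f bud l rr nr
          else exec P I o f bud nx rr nr
      | IJltN a b l =>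
          if Nat.ltb (nr a) (nr b) then exec P I o f bud l rr nr
          else exec P I o f bud nx rr nr
      | IRofN d a => exec P I o f bud nx (updR rr d (INR (nr a))) nr
      | IRAdd d a b => exec P I o f bud nx (updR rr d (rr a + rr b)) nr
      | IRSub d a b => exec P I o f bud nx (updR rr d (rr a - rr b)) nr
      | IRMul d a b => exec P I o f bud nx (updR rr d (rr a * rr b)) nr
      | IRDiv d a b => exec P I o f bud nx (updR rr d (rr a / rr b)) nr
      | IRExp d a => exec P I o f bud nx (updR rr d (exp (rr a))) nr
      | IRLn d a => exec P I o f bud nx (updR rr d (ln (rr a))) nr
      | IRSqrt d a => exec P I o f bud nx (updR rr d (sqrt (rr a))) nr
      | IRLoad d a => exec P I o f bud nx (updR rr d (rr (nr a))) nr
      | IRStore a s => exec P I o f bud nx (updR rr (nr a) (rr s)) nr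
      | INConst d k => exec P I o f bud nx rr (updN nr d k)
      | INAdd d a b => exec P I o f bud nx rr (updN nr d (nr a + nr b))
      | INSub d a b => exec P I o f bud nx rr (updN nr d (nr a - nr b))
      | INMul d a b => exec P I o f bud nx rr (updN nr d (nr a * nr b))
      | INLoad d a => exec P I o f bud nx rr (updN nr d (nr (nr a)))
      | INStore a s => exec P I o f bud nx rr (updN nr (nr a) (nr s))
      | IReadN d => exec P I o f bud nx rr (updN nr d (inst_n I))
      | IReadFlag d =>
          exec P I o f bud nx rr (updN nr d (if inst_flag I then 1 else 0)%nat)
      | IReadEdge d u v =>
          exec P I o f bud nx rr
               (updN nr d (if inst_edge I (nr u) (nr v) then 1 else 0)%nat)
      | IReadJ m d u v =>
          exec P I o f bud nx
               (updR rr d ((if m then J_nu I else J_mu I) (nr u) (nr v))) nr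
      | IReadH m d u =>
          exec P I o f bud nx (updR rr d ((if m then h_nu I else h_mu I) (nr u))) nr
      | IFlip d =>
          map (fun pa => (/ 2 * fst pa, snd pa))
              (exec P I o f bud nx rr (updN nr d 0%nat)
               ++ exec P I o f bud nx rr (updN nr d 1%nat))
      | ISample a e =>
          if Rle_dec (rr e) 0 then [(1, Failed)] else
          dbind (samp o (rr e))
                (fun s => exec P I o f bud nx (write_cfg rr (nr a) s) nr)
      | ICount m d e =>
          if Rle_dec (rr e) 0 then [(1, Failed)] else
          dbind (cnt o m (rr e))
                (fun z => exec P I o f bud nx (updR rr d z) nr)
      end
    end
  end.

Definition run (P : list instr) (I : instance) (o : oracles) (eps : R) (T : nat)
  : dist outcome :=
  exec P I o T T 0%nat (fun i => if Nat.eqb i 0 then eps else 0) (fun _ => 0%nat).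

Definition is_timeout (x : outcome) : bool :=
  match x with Timeout => true | _ => false end.

Definition within (eps D : R) (x : outcome) : bool :=
  match x with
  | Halted r => Rleb (exp (- eps) * D) r && Rleb r (exp eps * D)
  | _ => false
  end.

(* Main.v *)
(** Since [w_avg = sqrt (w_nu * w_mu)], the divergence is
    [D = 1 - Z_avg / sqrt (Z_nu * Z_mu)], and approximate counting determines it up to a small
    additive error.  This suffices unless [D] is tiny.

    Let [delta] be the l1 distance between the parameters of the two models.  Flipping one or
    two spins changes the log-likelihood ratio by an amount governed by a single difference of
    fields or couplings, and marginal boundedness keeps the weights of the flipped
    configurations comparable; hence [D] is at least [min(delta, 1) ^ 2] up to a factor
    polynomial in [n].  If [delta] exceeds [min(eps, 1) / 8], then [D] is at least inverse
    polynomial and counting works.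

    Otherwise write [Y = sqrt (nu / mu)]: as [E_mu (Y ^ 2) = 1] and [D = 1 - E_mu Y], the
    variance of [Y] is [D * (1 + E_mu Y)].  For small [delta] this shows that [D] agrees, up to
    a factor [exp (4 * delta)], with [1 / 16] of the mean of [(G s - G t) ^ 2] over
    independent samples [s, t], where [G] is the difference of the energies.  This random
    variable is at most [4 * delta ^ 2] and, by the lower bound on [D], has mean at least
    [delta ^ 2] divided by a polynomial, so an empirical mean over polynomially many pairs is
    accurate whatever the size of [delta]; the same holds with samples from [nu]. *)

Require Import Defs.
From Stdlib Require Import Reals List Arith Bool.
From Stdlib Require Import ZArith Lra Lia Psatz FinFun.
Import ListNotations.
(* [List.partition] would otherwise hide the partition function. *)
Import Defs.
Open Scope R_scope.

(** * Sums and spin flips *)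

Lemma lsum_cons {A} (a : A) l f : lsum (a :: l) f = f a + lsum l f.
Proof. reflexivity. Qed.

Lemma lsum_app {A} (l l' : list A) f : lsum (l ++ l') f = lsum l f + lsum l' f.
Proof.
  induction l as [|a l IH]; simpl.
  - unfold lsum at 2; simpl; lra.
  - rewrite !lsum_cons, IH; lra.
Qed.

Lemma lsum_ext {A} (l : list A) f g :
  (forall a, In a l -> f a = g a) -> lsum l f = lsum l g.
Proof.
  induction l as [|a l IH]; intros H; [reflexivity|].
  rewrite !lsum_cons, H by (left; reflexivity).
  rewrite IH; [reflexivity|]. intros; apply H; right; assumption.
Qed.

Lemma lsum_le {A} (l : list A) f g :
  (forall a, In a l -> f a <= g a) -> lsum l f <= lsum l g.
Proof.
  induction l as [|a l IH]; intros H; [unfold lsum; simpl; lra|].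
  rewrite !lsum_cons.
  pose proof (H a (or_introl eq_refl)).
  assert (lsum l f <= lsum l g) by (apply IH; intros; apply H; right; assumption).
  lra.
Qed.

Lemma lsum_plus {A} (l : list A) f g :
  lsum l (fun a => f a + g a) = lsum l f + lsum l g.
Proof.
  induction l as [|a l IH]; [unfold lsum; simpl; lra|].
  rewrite !lsum_cons, IH; lra.
Qed.

Lemma lsum_scal {A} (l : list A) c f : lsum l (fun a => c * f a) = c * lsum l f.
Proof.
  induction l as [|a l IH]; [unfold lsum; simpl; lra|].
  rewrite !lsum_cons, IH; lra.
Qed.

Lemma lsum_zero {A} (l : list A) f : (forall a, In a l -> f a = 0) -> lsum l f = 0.
Proof.
  intros H. rewrite (lsum_ext l f (fun a => 0 * f a)).
  - rewrite lsum_scal; lra.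
  - intros; rewrite H; auto; lra.
Qed.

Lemma lsum_nonneg {A} (l : list A) f : (forall a, In a l -> 0 <= f a) -> 0 <= lsum l f.
Proof.
  intros H. rewrite <- (lsum_zero l (fun _ => 0)); auto. apply lsum_le; assumption.
Qed.

Lemma lsum_abs {A} (l : list A) f : Rabs (lsum l f) <= lsum l (fun a => Rabs (f a)).
Proof.
  induction l as [|a l IH].
  - unfold lsum; simpl; rewrite Rabs_R0; lra.
  - rewrite !lsum_cons. eapply Rle_trans; [apply Rabs_triang|lra].
Qed.

Lemma lsum_map {A B} (h : A -> B) l f : lsum (map h l) f = lsum l (fun a => f (h a)).
Proof. unfold lsum; rewrite map_map; reflexivity. Qed.

Lemma lsum_swap {A B} (l : list A) (l' : list B) f :
  lsum l (fun a => lsum l' (f a)) = lsum l' (fun b => lsum l (fun a => f a b)).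
Proof.
  induction l as [|a l IH].
  - symmetry; apply lsum_zero; reflexivity.
  - rewrite lsum_cons, IH, <- lsum_plus. apply lsum_ext; reflexivity.
Qed.

Lemma lsum_single {A} (l : list A) f a :
  NoDup l -> In a l -> (forall x, In x l -> x <> a -> f x = 0) -> lsum l f = f a.
Proof.
  induction l as [|x l IH]; intros ND Ha Hz; [destruct Ha|].
  inversion ND as [|? ? Hx ND']; subst.
  rewrite lsum_cons. destruct Ha as [->|Ha].
  - rewrite (lsum_zero l); [lra|].
    intros y Hy. apply Hz; [right; assumption|]. intros ->; contradiction.
  - rewrite IH; auto.
    + rewrite Hz; [lra|left; reflexivity|]. intros ->; contradiction.
    + intros; apply Hz; [right|]; assumption.
Qed.

Lemma lsum_ge_term {A} (l : list A) f a :
  (forall x, In x l -> 0 <= f x) -> In a l -> f a <= lsum l f.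
Proof.
  induction l as [|x l IH]; intros Hp Ha; [destruct Ha|].
  rewrite lsum_cons.
  pose proof (Hp x (or_introl eq_refl)).
  assert (Hp' : forall y, In y l -> 0 <= f y) by (intros; apply Hp; right; assumption).
  pose proof (lsum_nonneg l f Hp').
  destruct Ha as [->|Ha]; [lra|]. specialize (IH Hp' Ha); lra.
Qed.

Lemma rsum_ext n f g : (forall i, (i < n)%nat -> f i = g i) -> rsum n f = rsum n g.
Proof.
  induction n as [|n IH]; intros H; simpl; [reflexivity|].
  rewrite IH, H by (intros; auto with arith); reflexivity.
Qed.

Lemma rsum_plus n f g : rsum n (fun i => f i + g i) = rsum n f + rsum n g.
Proof. induction n as [|n IH]; simpl; [lra|rewrite IH; lra]. Qed.

Lemma rsum_scal n c f : rsum n (fun i => c * f i) = c * rsum n f.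
Proof. induction n as [|n IH]; simpl; [lra|rewrite IH; lra]. Qed.

Lemma rsum_le n f g : (forall i, (i < n)%nat -> f i <= g i) -> rsum n f <= rsum n g.
Proof.
  induction n as [|n IH]; intros H; simpl; [lra|].
  apply Rplus_le_compat; [apply IH; intros|]; apply H; lia.
Qed.

Lemma rsum_const n c : rsum n (fun _ => c) = INR n * c.
Proof. induction n as [|n IH]; [simpl; lra|]. rewrite S_INR; simpl; rewrite IH; lra. Qed.

Lemma rsum_abs n f : Rabs (rsum n f) <= rsum n (fun i => Rabs (f i)).
Proof.
  induction n as [|n IH]; simpl; [rewrite Rabs_R0; lra|].
  eapply Rle_trans; [apply Rabs_triang|lra].
Qed.

Lemma rsum_delta n u c : (u < n)%nat ->
  rsum n (fun i => if Nat.eqb i u then c else 0) = c.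
Proof.
  induction n as [|n IH]; intros Hu; [lia|]. simpl.
  destruct (Nat.eqb_spec n u) as [->|Hne].
  - rewrite (rsum_ext u _ (fun _ => 0)).
    + rewrite rsum_const; lra.
    + intros i Hi. destruct (Nat.eqb_spec i u); [lia|reflexivity].
  - rewrite IH by lia; lra.
Qed.

(** * Configurations and spin flips *)

Lemma all_configs_length n s : In s (all_configs n) <-> length s = n.
Proof.
  revert s; induction n as [|n IH]; intros s; simpl.
  - split; [intros [<-|[]]; reflexivity|]. destruct s; [auto|discriminate].
  - rewrite in_app_iff, !in_map_iff. split.
    + intros [[t [<- Ht]]|[t [<- Ht]]]; simpl; f_equal; apply IH; assumption.
    + destruct s as [|[] s]; [discriminate| |]; intros [= Hs];
        [left|right]; exists s; split; auto; apply IH; assumption.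
Qed.

Lemma all_configs_NoDup n : NoDup (all_configs n).
Proof.
  induction n as [|n IH]; simpl; [repeat constructor; auto|].
  apply NoDup_app.
  - apply Injective_map_NoDup; [intros ? ? [=]; assumption|assumption].
  - apply Injective_map_NoDup; [intros ? ? [=]; assumption|assumption].
  - intros s. rewrite !in_map_iff. intros [t [<- _]] [t' [[=] _]].
Qed.

Fixpoint flip (u : nat) (s : list bool) : list bool :=
  match s, u with
  | [], _ => []
  | c :: s', 0%nat => negb c :: s'
  | c :: s', S u' => c :: flip u' s'
  end.

Lemma flip_length u s : length (flip u s) = length s.
Proof. revert u; induction s as [|c s IH]; intros [|u]; simpl; auto. Qed.

Lemma nth_flip u w s : (u < length s)%nat ->
  nth w (flip u s) false = if Nat.eqb w u then negb (nth w s false) else nth w s false.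
Proof.
  revert u w; induction s as [|c s IH]; intros [|u] [|w]; simpl; intros H; try lia; auto.
  apply IH; lia.
Qed.

Lemma sp_flip u w s : (u < length s)%nat ->
  sp (flip u s) w = sp s w + (if Nat.eqb w u then - 2 * sp s u else 0).
Proof.
  intros H. unfold sp. rewrite nth_flip by assumption.
  destruct (Nat.eqb_spec w u) as [->|]; [destruct (nth u s false); simpl; lra|lra].
Qed.

(** Flipping one spin permutes the configurations: at the head it exchanges the two halves of
    [all_configs], further down it acts inside each half. *)
Lemma lsum_flip n u F :
  lsum (all_configs n) (fun s => F (flip u s)) = lsum (all_configs n) F.
Proof.
  revert u F; induction n as [|n IH]; intros u F; simpl; [destruct u; reflexivity|].
  rewrite !lsum_app, !lsum_map. destruct u as [|u]; simpl.
  - apply Rplus_comm.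
  - rewrite (IH u (fun s => F (true :: s))), (IH u (fun s => F (false :: s))). reflexivity.
Qed.

Lemma sp_abs s u : Rabs (sp s u) = 1.
Proof.
  unfold sp, spin, Rabs; destruct (nth u s false); destruct Rcase_abs; lra.
Qed.

Lemma sp_sqr s u : sp s u * sp s u = 1.
Proof. unfold sp, spin; destruct (nth u s false); lra. Qed.

(** * The energy: linearity in the parameters and single flips *)

Lemma energy_sub n J J' h h' s :
  energy n J h s - energy n J' h' s
  = energy n (fun u v => J u v - J' u v) (fun u => h u - h' u) s.
Proof.
  unfold energy, Rminus.
  rewrite (rsum_ext n (fun u => (h u + - h' u) * sp s u)
             (fun u => h u * sp s u + (-1) * (h' u * sp s u))) by (intros; ring).
  rewrite rsum_plus, rsum_scal.
  rewrite (rsum_ext n (fun u => rsum n (fun v => (J u v + - J' u v) * sp s u * sp s v))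
             (fun u => rsum n (fun v => J u v * sp s u * sp s v)
                       + (-1) * rsum n (fun v => J' u v * sp s u * sp s v))).
  - rewrite rsum_plus, rsum_scal; lra.
  - intros i _. rewrite <- rsum_scal, <- rsum_plus. apply rsum_ext; intros; ring.
Qed.

(** After exponentiation this says that the weight of the averaged model is the geometric mean of
    the two weights. *)
Lemma energy_avg n J J' h h' s :
  energy n (fun u v => / 2 * (J u v + J' u v)) (fun u => / 2 * (h u + h' u)) s
  = / 2 * (energy n J h s + energy n J' h' s).
Proof.
  unfold energy.
  rewrite (rsum_ext n (fun u => / 2 * (h u + h' u) * sp s u)
             (fun u => / 2 * (h u * sp s u) + / 2 * (h' u * sp s u))) by (intros; ring).
  rewrite rsum_plus, !rsum_scal.
  rewrite (rsum_ext n (fun u => rsum n (fun v => / 2 * (J u v + J' u v) * sp s u * sp s v))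
             (fun u => / 2 * rsum n (fun v => J u v * sp s u * sp s v)
                       + / 2 * rsum n (fun v => J' u v * sp s u * sp s v))).
  - rewrite rsum_plus, !rsum_scal; lra.
  - intros i _. rewrite <- !rsum_scal, <- rsum_plus. apply rsum_ext; intros; ring.
Qed.

(** The sum runs over ordered pairs, so each coupling counts in both orders; the double loop of the
    program accumulates the same sum. *)
Definition param_norm n (J : nat -> nat -> R) (h : nat -> R) : R :=
  rsum n (fun u => Rabs (h u) + rsum n (fun v => Rabs (J u v))).

Lemma energy_abs n J h s : Rabs (energy n J h s) <= param_norm n J h.
Proof.
  unfold energy, param_norm. rewrite rsum_plus.
  eapply Rle_trans; [apply Rabs_triang|]. rewrite Rplus_comm. apply Rplus_le_compat.
  - eapply Rle_trans; [apply rsum_abs|]. apply rsum_le; intros i _.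
    rewrite Rabs_mult, sp_abs; lra.
  - rewrite Rabs_mult, (Rabs_right (/ 2)) by lra.
    assert (HA : Rabs (rsum n (fun u => rsum n (fun v => J u v * sp s u * sp s v)))
            <= rsum n (fun u => rsum n (fun v => Rabs (J u v)))).
    { eapply Rle_trans; [apply rsum_abs|]. apply rsum_le; intros i _.
      eapply Rle_trans; [apply rsum_abs|]. apply rsum_le; intros j _.
      rewrite !Rabs_mult, !sp_abs; lra. }
    pose proof (Rabs_pos (rsum n (fun u => rsum n (fun v => J u v * sp s u * sp s v)))).
    lra.
Qed.

(** Only terms with exactly one index equal to [u] change sign. By symmetry, row and column [u]
    contribute equally, which cancels the factor [/ 2]; the diagonal term is invariant and is
    therefore subtracted. *)
Lemma energy_flip n J h s u :
  (forall v w, (v < n)%nat -> (w < n)%nat -> J v w = J w v) ->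
  length s = n -> (u < n)%nat ->
  energy n J h s - energy n J h (flip u s)
  = 2 * sp s u * (h u + (rsum n (fun w => J u w * sp s w) - J u u * sp s u)).
Proof.
  intros HJ Hs Hu. unfold energy.
  (* [d] is the change of the spins, supported at [u]; [Hsum] collapses every sum against it. *)
  set (d := fun w => if Nat.eqb w u then - 2 * sp s u else 0).
  assert (Hd : forall w, sp (flip u s) w = sp s w + d w)
    by (intros; apply sp_flip; lia).
  assert (Hsum : forall f, rsum n (fun w => f w * d w) = - 2 * sp s u * f u).
  { intros f. rewrite <- (rsum_delta n u (- 2 * sp s u * f u)) by assumption.
    apply rsum_ext; intros i _; unfold d.
    destruct (Nat.eqb_spec i u) as [->|]; ring. }
  rewrite (rsum_ext n (fun v => h v * sp (flip u s) v)
             (fun v => h v * sp s v + h v * d v)) by (intros; rewrite Hd; ring).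
  rewrite rsum_plus, Hsum.
  set (L := rsum n (fun w => J u w * sp s w)).
  rewrite (rsum_ext n (fun v => rsum n (fun w => J v w * sp (flip u s) v * sp (flip u s) w))
    (fun v => rsum n (fun w => J v w * sp s v * sp s w)
              + ((- 2 * sp s u) * (J u v * sp s v)
              + ((rsum n (fun w => J v w * sp s w) * d v)
                 + (- 2 * sp s u * J v u) * d v)))).
  - rewrite !rsum_plus, rsum_scal, !Hsum. fold L.
    generalize (sp_sqr s u). intros. nra.
  - intros v Hv.
    rewrite (rsum_ext n _ (fun w => J v w * sp s v * sp s w + ((J v w * (sp s v + d v)) * d w
         + d v * (J v w * sp s w))))
      by (intros; rewrite !Hd; ring).
    rewrite !rsum_plus, rsum_scal, (Hsum (fun w => J v w * (sp s v + d v))).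
    rewrite (HJ u v) by assumption. ring.
Qed.

(** * Gibbs distributions and the lower bound on the divergence *)

Lemma partition_pos n J h : 0 < partition n J h.
Proof.
  unfold partition.
  apply Rlt_le_trans with (gweight n J h (repeat true n)); [apply exp_pos|].
  apply lsum_ge_term; [intros; apply Rlt_le, exp_pos|].
  apply all_configs_length, repeat_length.
Qed.

Lemma gibbs_exp n J h s : gibbs n J h s = exp (energy n J h s - ln (partition n J h)).
Proof.
  unfold gibbs, gweight, Rminus, Rdiv.
  rewrite exp_plus, exp_Ropp, exp_ln by apply partition_pos. reflexivity.
Qed.

Lemma gibbs_pos n J h s : 0 < gibbs n J h s.
Proof. rewrite gibbs_exp; apply exp_pos. Qed.

Lemma gibbs_sum n J h : lsum (all_configs n) (gibbs n J h) = 1.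
Proof.
  rewrite (lsum_ext _ _ (fun s => / partition n J h * gweight n J h s)).
  - rewrite lsum_scal. apply Rinv_l, Rgt_not_eq, partition_pos.
  - intros; unfold gibbs; field. apply Rgt_not_eq, partition_pos.
Qed.

(** Pin every spin except [u] to its value in [s]. Only [s] and [flip u s] are compatible, so the
    conditional marginal of the flipped value is the mass of [flip u s] divided by a quantity at
    least the mass of [s]. *)
Lemma gibbs_flip_ge n J h b s u :
  marginally_bounded n J h b -> 0 <= b -> length s = n -> (u < n)%nat ->
  b * gibbs n J h s <= gibbs n J h (flip u s).
Proof.
  intros Hb Hb0 Hs Hu.
  set (tau := fun w => if Nat.eqb w u then None else Some (nth w s false)).
  assert (Htau : tau u = None) by (unfold tau; rewrite Nat.eqb_refl; reflexivity).
  assert (Hcompat : forall t, compatb n tau t = true <->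
            forall w, (w < n)%nat -> w <> u -> nth w t false = nth w s false).
  { intros t. unfold compatb. rewrite forallb_forall. split.
    - intros H w Hw Hne. specialize (H w). rewrite in_seq in H.
      specialize (H ltac:(lia)). unfold tau in H.
      destruct (Nat.eqb_spec w u); [contradiction|]. apply eqb_prop; assumption.
    - intros H w Hw. rewrite in_seq in Hw. unfold tau.
      destruct (Nat.eqb_spec w u); [reflexivity|].
      rewrite H by (auto; lia). apply eqb_reflx. }
  specialize (Hb tau u (negb (nth u s false)) Hu Htau). unfold cond_marginal in Hb.
  set (num := lsum _ _) in Hb. set (den := lsum _ _) in Hb.
  assert (Hnum : num = gibbs n J h (flip u s)).
  { unfold num.
    rewrite (lsum_single _ _ (flip u s)).
    - replace (compatb n tau (flip u s)) with true.
      + rewrite nth_flip, Nat.eqb_refl, eqb_reflx by lia. reflexivity.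
      + symmetry. apply Hcompat. intros w Hw Hne. rewrite nth_flip by lia.
        destruct (Nat.eqb_spec w u); [contradiction|reflexivity].
    - apply all_configs_NoDup.
    - apply all_configs_length; rewrite flip_length; assumption.
    - intros t Ht Hne. apply all_configs_length in Ht.
      destruct (compatb n tau t) eqn:Hc; [|reflexivity]. simpl.
      destruct (eqb _ _) eqn:He; [|reflexivity].
      exfalso; apply Hne. apply eqb_prop in He. rewrite Hcompat in Hc.
      apply nth_ext with (d := false) (d' := false); [rewrite flip_length; congruence|].
      intros w Hw. rewrite nth_flip by lia.
      destruct (Nat.eqb_spec w u) as [->|]; [assumption|apply Hc; lia]. }
  assert (Hden : gibbs n J h s <= den).
  { assert (Hc : compatb n tau s = true) by (apply Hcompat; reflexivity).
    pose proof (lsum_ge_term (all_configs n)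
                  (fun t => if compatb n tau t then gibbs n J h t else 0) s) as G.
    cbv beta in G. rewrite Hc in G. apply G; [|apply all_configs_length; assumption].
    intros t _. destruct (compatb n tau t); [apply Rlt_le, gibbs_pos|lra]. }
  pose proof (gibbs_pos n J h s). rewrite <- Hnum.
  apply Rle_trans with (b * den); [apply Rmult_le_compat_l; assumption|].
  apply Rmult_le_reg_r with (/ den); [apply Rinv_0_lt_compat; lra|].
  replace (b * den * / den) with b by (field; lra). assumption.
Qed.

(* Half the log-likelihood ratio, so that [exp (half_llr s) = sqrt (nu s / mu s)]. *)
Definition half_llr n J h J' h' s :=
  / 2 * (energy n J h s - ln (partition n J h)
         - (energy n J' h' s - ln (partition n J' h'))).

Definition hellinger n J h J' h' := f_div hell_f (gibbs n J h) (gibbs n J' h') n.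

Lemma sqrt_gibbs_ratio n J h J' h' s :
  sqrt (gibbs n J h s / gibbs n J' h' s) = exp (half_llr n J h J' h' s).
Proof.
  rewrite !gibbs_exp. unfold Rdiv. rewrite <- exp_Ropp, <- exp_plus.
  rewrite <- (sqrt_Rsqr (exp (half_llr n J h J' h' s))) by apply Rlt_le, exp_pos.
  unfold Rsqr. rewrite <- exp_plus. unfold half_llr. f_equal. f_equal. lra.
Qed.

Lemma hellinger_eq n J h J' h' :
  hellinger n J h J' h'
  = lsum (all_configs n)
      (fun s => / 2 * gibbs n J' h' s * (exp (half_llr n J h J' h' s) - 1) ^ 2).
Proof.
  unfold hellinger, f_div, hell_f. apply lsum_ext. intros s _.
  cbv beta. rewrite sqrt_gibbs_ratio. ring.
Qed.

(** Expanding the square gives [nu / 2 + mu / 2 - sqrt (nu * mu)] in each term. The remaining sum is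
    the Bhattacharyya coefficient, written as a sum of exponentials so that symmetry in the two
    models is visible. *)
Lemma hellinger_affinity n J h J' h' :
  hellinger n J h J' h'
  = 1 - lsum (all_configs n) (fun s => exp (/ 2 * (energy n J h s - ln (partition n J h)
         + (energy n J' h' s - ln (partition n J' h'))))).
Proof.
  rewrite hellinger_eq.
  rewrite (lsum_ext _ _ (fun s => (/ 2 * gibbs n J h s + / 2 * gibbs n J' h' s)
     + (-1) * exp (/ 2 * (energy n J h s - ln (partition n J h)
         + (energy n J' h' s - ln (partition n J' h')))))).
  - rewrite !lsum_plus, !lsum_scal, !gibbs_sum. lra.
  - intros s _.
    assert (H1 : gibbs n J h s = gibbs n J' h' s * (exp (half_llr n J h J' h' s)
               * exp (half_llr n J h J' h' s))).
    { rewrite !gibbs_exp, <- !exp_plus. f_equal. unfold half_llr. lra. }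
    assert (H2 : exp (/ 2 * (energy n J h s - ln (partition n J h)
                   + (energy n J' h' s - ln (partition n J' h'))))
               = gibbs n J' h' s * exp (half_llr n J h J' h' s)).
    { rewrite gibbs_exp, <- exp_plus. f_equal. unfold half_llr. lra. }
    rewrite H1, H2. field.
Qed.

Lemma hellinger_sym n J h J' h' : hellinger n J h J' h' = hellinger n J' h' J h.
Proof.
  rewrite !hellinger_affinity. f_equal. apply lsum_ext. intros. f_equal. lra.
Qed.

Lemma hellinger_nonneg n J h J' h' : 0 <= hellinger n J h J' h'.
Proof.
  rewrite hellinger_eq. apply lsum_nonneg. intros s _.
  pose proof (gibbs_pos n J' h' s). apply Rmult_le_pos; [lra|apply pow2_ge_0].
Qed.

(** By [energy_avg] the summands of the Bhattacharyya coefficient are weights of the averaged model,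
    and the normalisations factor out. The counting branch evaluates this formula. *)
Lemma hellinger_partition n J h J' h' :
  hellinger n J h J' h'
  = 1 - partition n (fun u v => / 2 * (J u v + J' u v)) (fun u => / 2 * (h u + h' u))
        / sqrt (partition n J h * partition n J' h').
Proof.
  rewrite hellinger_affinity. f_equal.
  pose proof (partition_pos n J h) as P. pose proof (partition_pos n J' h') as P'.
  set (Z := partition n J h) in *. set (Z' := partition n J' h') in *.
  assert (HS : / sqrt (Z * Z') = exp (- / 2 * (ln Z + ln Z'))).
  { rewrite <- ln_mult by assumption.
    replace (- / 2 * ln (Z * Z')) with (- (/ 2 * ln (Z * Z'))) by ring.
    rewrite exp_Ropp. f_equal.
    rewrite <- (sqrt_Rsqr (exp _)) by apply Rlt_le, exp_pos.
    f_equal. unfold Rsqr. rewrite <- exp_plus.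
    replace (/ 2 * ln (Z * Z') + / 2 * ln (Z * Z')) with (ln (Z * Z')) by lra.
    rewrite exp_ln; [reflexivity|]. apply Rmult_lt_0_compat; assumption. }
  unfold Rdiv. rewrite HS. unfold partition. rewrite Rmult_comm, <- lsum_scal.
  apply lsum_ext. intros s _. unfold gweight. rewrite <- exp_plus, energy_avg.
  f_equal. lra.
Qed.

Lemma exp_le_mono x y : x <= y -> exp x <= exp y.
Proof. intros [H| ->]; [left; apply exp_increasing; assumption|right; reflexivity]. Qed.

(** For negative [x] this is monotonicity. For positive [x] it also uses [exp r + exp (- r) >= 2],
    that is, [exp r - 1 >= 1 - exp (- r)]. *)
Lemma sqr_exp_sub1_ge x r :
  0 <= r -> r <= Rabs x -> (1 - exp (- r)) ^ 2 <= (exp x - 1) ^ 2.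
Proof.
  intros Hr Hx.
  assert (H1 : exp (- r) <= 1) by (rewrite <- exp_0; apply exp_le_mono; lra).
  pose proof (exp_pos (- r)) as Hp.
  unfold Rabs in Hx. destruct (Rcase_abs x).
  - assert (exp x <= exp (- r)) by (apply exp_le_mono; lra). nra.
  - assert (exp r <= exp x) by (apply exp_le_mono; lra).
    assert (exp r * exp (- r) = 1)
      by (rewrite <- exp_plus, <- exp_0; f_equal; ring).
    pose proof (exp_pos r).
    assert (2 <= exp r + exp (- r)) by nra.
    assert (1 - exp (- r) <= exp x - 1) by lra. nra.
Qed.

(** From [exp (- x) <= 1 / (1 + x)] and [1 + x <= 2]. *)
Lemma one_sub_exp_ge x : 0 <= x <= 1 -> x / 2 <= 1 - exp (- x).
Proof.
  intros [H0 H1]. pose proof (exp_ineq1_le x).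
  assert (exp x * exp (- x) = 1) by (rewrite <- exp_plus, <- exp_0; f_equal; ring).
  pose proof (exp_pos (- x)). nra.
Qed.

(** * Lower bound on the divergence by the distance of the parameters *)

Section LowerBound.

Variables (n : nat) (J J' : nat -> nat -> R) (h h' : nat -> R) (b : R).
Hypothesis b_pos : 0 < b.
Hypothesis b_le1 : b <= 1.
Hypothesis mu_bounded : marginally_bounded n J' h' b.
Hypothesis J_sym : forall u v, (u < n)%nat -> (v < n)%nat -> J u v = J v u.
Hypothesis J'_sym : forall u v, (u < n)%nat -> (v < n)%nat -> J' u v = J' v u.
Hypothesis J_diag : forall u, (u < n)%nat -> J u u = 0.
Hypothesis J'_diag : forall u, (u < n)%nat -> J' u u = 0.

Let dJ u v := J u v - J' u v.
Let dh u := h u - h' u.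
Let x := half_llr n J h J' h'.
Let mu := gibbs n J' h'.
Let D := hellinger n J h J' h'.
Let Phi s := / 2 * mu s * (exp (x s) - 1) ^ 2.

Lemma hellinger_Phi : D = lsum (all_configs n) Phi.
Proof. apply hellinger_eq. Qed.

(** The log-partition constants cancel and the diagonal couplings vanish, which leaves the local
    field at [u] of the difference model. *)
Lemma half_llr_flip s u : length s = n -> (u < n)%nat ->
  x s - x (flip u s) = sp s u * (dh u + rsum n (fun w => dJ u w * sp s w)).
Proof.
  intros Hs Hu.
  assert (Hx : forall t, x t = / 2 * energy n dJ dh t
                 + / 2 * (ln (partition n J' h') - ln (partition n J h))).
  { intros t. unfold x, half_llr, dJ, dh. rewrite <- energy_sub. lra. }
  rewrite !Hx.
  assert (HE : energy n dJ dh s - energy n dJ dh (flip u s)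
     = 2 * sp s u * (dh u + (rsum n (fun w => dJ u w * sp s w) - dJ u u * sp s u))).
  { apply energy_flip; try assumption. intros; unfold dJ; rewrite J_sym, J'_sym; auto. }
  assert (dJ u u = 0) by (unfold dJ; rewrite J_diag, J'_diag by assumption; lra).
  rewrite H in HE. lra.
Qed.

(** This mixed second difference isolates one coupling: flipping [v] changes the local field at [u]
    only through [dJ u v]. *)
Lemma half_llr_flip2 s u v : length s = n -> (u < n)%nat -> (v < n)%nat -> u <> v ->
  x s - x (flip u s) - x (flip v s) + x (flip u (flip v s))
  = 2 * dJ u v * (sp s u * sp s v).
Proof.
  intros Hs Hu Hv Huv.
  pose proof (half_llr_flip s u Hs Hu) as H1.
  assert (Hs' : length (flip v s) = n) by (rewrite flip_length; assumption).
  pose proof (half_llr_flip (flip v s) u Hs' Hu) as H2.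
  rewrite sp_flip in H2 by lia. destruct (Nat.eqb_spec u v); [contradiction|].
  rewrite (rsum_ext n _ (fun w => dJ u w * sp s w
       + (if Nat.eqb w v then - 2 * dJ u v * sp s v else 0))) in H2.
  - rewrite rsum_plus, rsum_delta in H2 by assumption. lra.
  - intros w _. rewrite sp_flip by lia. destruct (Nat.eqb_spec w v) as [->|]; ring.
Qed.

Lemma Phi_nonneg s : 0 <= Phi s.
Proof.
  unfold Phi, mu. pose proof (gibbs_pos n J' h' s).
  apply Rmult_le_pos; [lra|apply pow2_ge_0].
Qed.

(** Charges the contribution of a nearby configuration [t] to the mass of [s], so that the bounds
    can be summed over [s] against total mass 1. *)
Lemma Phi_ge s t c r : 0 <= c -> c * mu s <= mu t -> 0 <= r -> r <= Rabs (x t) ->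
  c / 2 * (1 - exp (- r)) ^ 2 * mu s <= Phi t.
Proof.
  intros Hc Hst Hr Hx. pose proof (sqr_exp_sub1_ge _ _ Hr Hx). unfold Phi.
  pose proof (pow2_ge_0 (1 - exp (- r))).
  assert (0 < mu s) by apply gibbs_pos.
  replace (c / 2 * (1 - exp (- r)) ^ 2 * mu s)
    with (/ 2 * (c * mu s) * (1 - exp (- r)) ^ 2) by lra.
  apply Rmult_le_compat; [|assumption|lra|assumption].
  pose proof (Rmult_le_pos _ _ Hc (Rlt_le _ _ H1)). lra.
Qed.

(* By [half_llr_flip2], one of the four configurations obtained from [s] by flipping [u]
   and [v] has [Rabs x >= r / 2]. *)
Lemma hellinger_ge_J u v r : (u < n)%nat -> (v < n)%nat -> u <> v ->
  0 <= r -> r <= Rabs (dJ u v) -> b ^ 2 / 8 * (1 - exp (- (r / 2))) ^ 2 <= D.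
Proof.
  intros Hu Hv Huv Hr HJ.
  (* Flips permute the configurations, so each of the four sums equals [D]. *)
  assert (H4 : 4 * D = lsum (all_configs n)
     (fun s => Phi s + Phi (flip u s) + (Phi (flip v s) + Phi (flip u (flip v s))))).
  { rewrite !lsum_plus, (lsum_flip n v (fun s => Phi (flip u s))), !lsum_flip, hellinger_Phi. lra. }
  assert (Hle : b ^ 2 / 2 * (1 - exp (- (r / 2))) ^ 2 <= 4 * D); [|lra].
  rewrite H4.
  replace (b ^ 2 / 2 * (1 - exp (- (r / 2))) ^ 2)
    with (b ^ 2 / 2 * (1 - exp (- (r / 2))) ^ 2 * lsum (all_configs n) mu)
    by (unfold mu; rewrite gibbs_sum; ring).
  rewrite <- lsum_scal. apply lsum_le. intros s Hs. apply all_configs_length in Hs.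
  pose proof (half_llr_flip2 s u v Hs Hu Hv Huv) as Hmix.
  assert (Hs' : length (flip v s) = n) by (rewrite flip_length; assumption).
  assert (Mu : b * mu s <= mu (flip u s)) by (apply gibbs_flip_ge; auto; lra).
  assert (Mv : b * mu s <= mu (flip v s)) by (apply gibbs_flip_ge; auto; lra).
  assert (Muv : b * mu (flip v s) <= mu (flip u (flip v s)))
    by (apply gibbs_flip_ge; auto; lra).
  assert (M0 : 0 < mu s) by apply gibbs_pos.
  (* Two flips cost a factor [b ^ 2]; as [b <= 1], the same factor serves for one flip or none. *)
  assert (Hb2 : 0 <= b ^ 2) by apply pow2_ge_0.
  assert (Hb2b : b ^ 2 * mu s <= b * mu s) by (apply Rmult_le_compat_r; nra).
  assert (Hb21 : b ^ 2 * mu s <= mu s).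
  { rewrite <- (Rmult_1_l (mu s)) at 2. apply Rmult_le_compat_r; nra. }
  assert (Hb2uv : b ^ 2 * mu s <= mu (flip u (flip v s))).
  { eapply Rle_trans; [|apply Muv].
    replace (b ^ 2 * mu s) with (b * (b * mu s)) by ring. apply Rmult_le_compat_l; lra. }
  pose proof (Phi_nonneg s). pose proof (Phi_nonneg (flip u s)).
  pose proof (Phi_nonneg (flip v s)). pose proof (Phi_nonneg (flip u (flip v s))).
  assert (Hr2 : 0 <= r / 2) by lra.
  assert (Habs : 2 * r <= Rabs (x s - x (flip u s) - x (flip v s) + x (flip u (flip v s)))).
  { rewrite Hmix, !Rabs_mult, !sp_abs, (Rabs_right 2) by lra. lra. }
  destruct (Rle_dec (r / 2) (Rabs (x s))) as [L1|L1].
  { pose proof (Phi_ge s s _ _ Hb2 Hb21 Hr2 L1). lra. }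
  destruct (Rle_dec (r / 2) (Rabs (x (flip u s)))) as [L2|L2].
  { pose proof (Phi_ge s (flip u s) _ _ Hb2 ltac:(lra) Hr2 L2). lra. }
  destruct (Rle_dec (r / 2) (Rabs (x (flip v s)))) as [L3|L3].
  { pose proof (Phi_ge s (flip v s) _ _ Hb2 ltac:(lra) Hr2 L3). lra. }
  assert (L4 : r / 2 <= Rabs (x (flip u (flip v s)))).
  { revert Habs L1 L2 L3. unfold Rabs. repeat destruct Rcase_abs; lra. }
  pose proof (Phi_ge s (flip u (flip v s)) _ _ Hb2 Hb2uv Hr2 L4). lra.
Qed.

(** The local field at [u] has absolute value at least [r] whatever the other spins, so [s] or
    [flip u s] has [Rabs x >= r / 2]. The constant is weakened to that of [hellinger_ge_J]. *)
Lemma hellinger_ge_h u r : (u < n)%nat -> 0 <= r ->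
  r <= Rabs (dh u) - rsum n (fun w => Rabs (dJ u w)) ->
  b ^ 2 / 8 * (1 - exp (- (r / 2))) ^ 2 <= D.
Proof.
  intros Hu Hr Hh.
  assert (H2 : 2 * D = lsum (all_configs n) (fun s => Phi s + Phi (flip u s))).
  { rewrite lsum_plus, lsum_flip, hellinger_Phi. lra. }
  assert (Hle : b ^ 2 / 2 * (1 - exp (- (r / 2))) ^ 2 <= 2 * D).
  2:{ pose proof (hellinger_nonneg n J h J' h'). fold D in H. lra. }
  rewrite H2.
  replace (b ^ 2 / 2 * (1 - exp (- (r / 2))) ^ 2)
    with (b ^ 2 / 2 * (1 - exp (- (r / 2))) ^ 2 * lsum (all_configs n) mu)
    by (unfold mu; rewrite gibbs_sum; ring).
  rewrite <- lsum_scal. apply lsum_le. intros s Hs. apply all_configs_length in Hs.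
  assert (Mu : b * mu s <= mu (flip u s)) by (apply gibbs_flip_ge; auto; lra).
  assert (M0 : 0 < mu s) by apply gibbs_pos.
  assert (Hb2 : 0 <= b ^ 2) by apply pow2_ge_0.
  assert (Hb2b : b ^ 2 * mu s <= b * mu s) by (apply Rmult_le_compat_r; nra).
  assert (Hb21 : b ^ 2 * mu s <= mu s).
  { rewrite <- (Rmult_1_l (mu s)) at 2. apply Rmult_le_compat_r; nra. }
  pose proof (Phi_nonneg s). pose proof (Phi_nonneg (flip u s)).
  assert (Hr2 : 0 <= r / 2) by lra.
  assert (Habs : r <= Rabs (x s - x (flip u s))).
  { rewrite half_llr_flip, Rabs_mult, sp_abs by assumption.
    assert (Rabs (rsum n (fun w => dJ u w * sp s w)) <= rsum n (fun w => Rabs (dJ u w))).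
    { eapply Rle_trans; [apply rsum_abs|]. apply rsum_le; intros.
      rewrite Rabs_mult, sp_abs; lra. }
    pose proof (Rabs_triang (dh u + rsum n (fun w => dJ u w * sp s w))
                  (- rsum n (fun w => dJ u w * sp s w))) as T.
    rewrite Rabs_Ropp in T.
    replace (dh u + _ + - _) with (dh u) in T by ring. lra. }
  destruct (Rle_dec (r / 2) (Rabs (x s))) as [L1|L1].
  { pose proof (Phi_ge s s _ _ Hb2 Hb21 Hr2 L1). lra. }
  assert (L2 : r / 2 <= Rabs (x (flip u s))).
  { revert Habs L1. unfold Rabs. repeat destruct Rcase_abs; lra. }
  pose proof (Phi_ge s (flip u s) _ _ Hb2 ltac:(lra) Hr2 L2). lra.
Qed.

(** Pigeonhole over the parameters. If the bound failed, [hellinger_ge_J] would force every coupling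
    difference to be at most [r], and [hellinger_ge_h] every field difference to be at most
    [(n + 1) * r]. The norm, which is [4 * (n + 1) ^ 2 * r], would be at most
    [n * (2 * n + 1) * r]. *)
Lemma hellinger_ge_exp :
  b ^ 2 / 8 * (1 - exp (- (param_norm n dJ dh / (8 * (INR n + 1) ^ 2)))) ^ 2 <= D.
Proof.
  set (N := INR n + 1).
  assert (HN : 1 <= N) by (unfold N; pose proof (pos_INR n); lra).
  set (r := param_norm n dJ dh / (4 * N ^ 2)).
  replace (param_norm n dJ dh / (8 * N ^ 2)) with (r / 2) by (unfold r; field; lra).
  assert (Hd : param_norm n dJ dh = 4 * N ^ 2 * r) by (unfold r; field; lra).
  apply Rnot_lt_le. intros Hlt.
  assert (Hdiag : forall u, (u < n)%nat -> dJ u u = 0)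
    by (intros; unfold dJ; rewrite J_diag, J'_diag by assumption; lra).
  assert (Hr0 : 0 <= r).
  { apply Rmult_le_reg_l with (4 * N ^ 2); [nra|]. rewrite <- Hd, Rmult_0_r.
    unfold param_norm. rewrite <- (Rmult_0_r (INR n)), <- rsum_const.
    apply rsum_le. intros u _.
    assert (rsum n (fun _ => 0) <= rsum n (fun v => Rabs (dJ u v)))
      by (apply rsum_le; intros; apply Rabs_pos).
    rewrite rsum_const in H. pose proof (Rabs_pos (dh u)). lra. }
  assert (HJ : forall u v, (u < n)%nat -> (v < n)%nat -> Rabs (dJ u v) <= r).
  { intros u v Hu Hv. destruct (Nat.eq_dec u v) as [->|Hne].
    - rewrite Hdiag, Rabs_R0; assumption.
    - apply Rnot_lt_le; intros H. apply Rlt_not_le in Hlt. apply Hlt.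
      apply (hellinger_ge_J u v); auto; lra. }
  assert (HS : forall u, (u < n)%nat -> rsum n (fun v => Rabs (dJ u v)) <= INR n * r).
  { intros u Hu. rewrite <- rsum_const. apply rsum_le; auto. }
  assert (Hh : forall u, (u < n)%nat -> Rabs (dh u) <= N * r).
  { intros u Hu. apply Rnot_lt_le; intros H. apply Rlt_not_le in Hlt. apply Hlt.
    apply (hellinger_ge_h u); auto. specialize (HS u Hu). unfold N in H. lra. }
  assert (Hp : param_norm n dJ dh <= INR n * (N * r + INR n * r)).
  { unfold param_norm. rewrite <- rsum_const. apply rsum_le; intros u Hu.
    apply Rplus_le_compat; auto. }
  pose proof (pos_INR n).
  assert (Hn : INR n = N - 1) by (unfold N; lra). rewrite Hn in Hp.
  rewrite Hd in Hp.
  (* The two values of the norm are compatible only for [r = 0], where the bound to be proved is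
     0. *)
  assert (r = 0) by nra.
  rewrite H0 in Hlt. replace (- (0 / 2)) with 0 in Hlt by lra. rewrite exp_0 in Hlt.
  pose proof (hellinger_nonneg n J h J' h'). fold D in H1. lra.
Qed.

(** Capping the norm at [m <= 1] allows the linear bound [one_sub_exp_ge]. The constant is
    [2048 = 8 * (2 * 8) ^ 2]. *)
Lemma hellinger_ge m : 0 <= m <= 1 -> m <= param_norm n dJ dh ->
  b ^ 2 * m ^ 2 / (2048 * (INR n + 1) ^ 4) <= D.
Proof.
  intros [Hm0 Hm1] Hm. eapply Rle_trans; [|apply hellinger_ge_exp].
  set (N := INR n + 1).
  assert (HN : 1 <= N) by (unfold N; pose proof (pos_INR n); lra).
  set (y := m / (8 * N ^ 2)).
  assert (HN2 : 1 <= N ^ 2) by nra.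
  assert (Hinv : 0 < / (8 * N ^ 2)) by (apply Rinv_0_lt_compat; lra).
  assert (Hinv1 : / (8 * N ^ 2) <= 1)
    by (rewrite <- Rinv_1; apply Rinv_le_contravar; lra).
  assert (Hy : 0 <= y <= 1) by (unfold y, Rdiv; split; nra).
  assert (Hyd : y <= param_norm n dJ dh / (8 * N ^ 2))
    by (unfold y, Rdiv; apply Rmult_le_compat_r; lra).
  pose proof (one_sub_exp_ge y Hy).
  assert (exp (- (param_norm n dJ dh / (8 * N ^ 2))) <= exp (- y))
    by (apply exp_le_mono; lra).
  replace (b ^ 2 * m ^ 2 / (2048 * N ^ 4)) with (b ^ 2 / 8 * (y / 2) ^ 2)
    by (unfold y; field; lra).
  apply Rmult_le_compat_l; [pose proof (pow2_ge_0 b); lra|].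
  apply pow_incr; lra.
Qed.

End LowerBound.

(** * Expectations and the variance of the likelihood ratio *)

Definition ev {A} (d : dist A) (F : A -> R) : R := lsum d (fun pa => fst pa * F (snd pa)).

Lemma ev_plus {A} (d : dist A) F G : ev d (fun a => F a + G a) = ev d F + ev d G.
Proof. unfold ev. rewrite <- lsum_plus. apply lsum_ext; intros; ring. Qed.

Lemma ev_scal {A} (d : dist A) c F : ev d (fun a => c * F a) = c * ev d F.
Proof. unfold ev. rewrite <- lsum_scal. apply lsum_ext; intros; ring. Qed.

Lemma ev_const {A} (d : dist A) c : is_dist d -> ev d (fun _ => c) = c.
Proof.
  intros [_ H1]. unfold ev. rewrite (lsum_ext _ _ (fun pa => c * fst pa)).
  - rewrite lsum_scal, H1; ring.
  - intros; ring.
Qed.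

Lemma ev_ext {A} (d : dist A) F G :
  (forall pa, In pa d -> F (snd pa) = G (snd pa)) -> ev d F = ev d G.
Proof. intros H. apply lsum_ext. intros; rewrite H; auto. Qed.

Lemma ev_le {A} (d : dist A) F G : is_dist d ->
  (forall pa, In pa d -> F (snd pa) <= G (snd pa)) -> ev d F <= ev d G.
Proof.
  intros [H0 _] H. rewrite Forall_forall in H0.
  apply lsum_le. intros pa Hpa. apply Rmult_le_compat_l; auto.
Qed.

Lemma ev_abs_le {A} (d : dist A) F c : is_dist d ->
  (forall pa, In pa d -> Rabs (F (snd pa)) <= c) -> Rabs (ev d F) <= c.
Proof.
  intros Hd H. apply Rabs_le. split.
  - rewrite <- (ev_const d (- c)) by assumption. apply ev_le; auto.
    intros pa Hpa. specialize (H pa Hpa). revert H; unfold Rabs; destruct Rcase_abs; lra.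
  - rewrite <- (ev_const d c) by assumption. apply ev_le; auto.
    intros pa Hpa. specialize (H pa Hpa). revert H; unfold Rabs; destruct Rcase_abs; lra.
Qed.

Lemma prob_ev {A} (d : dist A) Q : prob d Q = ev d (fun a => if Q a then 1 else 0).
Proof. apply lsum_ext. intros [p a] _; simpl. destruct (Q a); ring. Qed.

Lemma prob_dbind {A B} (d : dist A) (f : A -> dist B) Q :
  prob (dbind d f) Q = ev d (fun a => prob (f a) Q).
Proof.
  unfold prob, dbind, ev. induction d as [|[p a] d IH]; [reflexivity|].
  simpl. rewrite lsum_app, lsum_cons, IH, lsum_map. f_equal.
  rewrite <- lsum_scal. apply lsum_ext. intros [q c] _; simpl. destruct (Q c); ring.
Qed.

(** A [dist] may list an outcome several times; exchanging the sums groups the entries by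
    configuration. The length condition places every outcome in [all_configs]. *)
Lemma ev_mass n (d : dist (list bool)) F :
  Forall (fun pa => length (snd pa) = n) d ->
  ev d F = lsum (all_configs n) (fun s => mass d s * F s).
Proof.
  intros H. rewrite Forall_forall in H.
  rewrite (lsum_ext (all_configs n) _ (fun s => lsum d (fun pa =>
     if list_eq_dec bool_dec (snd pa) s then fst pa * F s else 0))).
  - rewrite lsum_swap. apply lsum_ext. intros pa Hpa.
    rewrite (lsum_single _ _ (snd pa)).
    + destruct list_eq_dec; [reflexivity|contradiction].
    + apply all_configs_NoDup.
    + apply all_configs_length; auto.
    + intros s _ Hne. destruct list_eq_dec; [congruence|reflexivity].
  - intros s _. unfold mass, prob. rewrite Rmult_comm, <- lsum_scal. apply lsum_ext.
    intros pa _. destruct list_eq_dec; ring.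
Qed.

Lemma ev_tv n d g F c z :
  Forall (fun pa => length (snd pa) = n) d -> tv_to_gibbs n d g <= z -> 0 <= c ->
  (forall s, Rabs (F s) <= c) ->
  Rabs (ev d F - lsum (all_configs n) (fun s => g s * F s)) <= 2 * z * c.
Proof.
  intros Hl Htv Hc HF. rewrite (ev_mass n) by assumption.
  replace (lsum _ _ - _) with (lsum (all_configs n) (fun s => (mass d s - g s) * F s)).
  - eapply Rle_trans; [apply lsum_abs|].
    apply Rle_trans with (c * lsum (all_configs n) (fun s => Rabs (mass d s - g s))).
    + rewrite <- lsum_scal. apply lsum_le. intros s _.
      rewrite Rabs_mult, Rmult_comm. apply Rmult_le_compat_r; [apply Rabs_pos|auto].
    + unfold tv_to_gibbs in Htv. rewrite Rmult_comm. apply Rmult_le_compat_r; lra.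
  - rewrite (lsum_ext _ _ (fun s => mass d s * F s + (-1) * (g s * F s))).
    + rewrite lsum_plus, lsum_scal. ring.
    + intros; ring.
Qed.

(** Hybrid argument: replacing the law of the inner sample by [g] costs [2 * z * c], and replacing
    that of the outer one costs as much again, since the averaged function [W'] is still bounded by
    [c]. *)
Lemma ev2_tv n d g W c z :
  is_dist d -> Forall (fun pa => length (snd pa) = n) d ->
  (forall s, 0 <= g s) -> lsum (all_configs n) g = 1 ->
  tv_to_gibbs n d g <= z -> 0 <= c -> (forall s t, Rabs (W s t) <= c) ->
  Rabs (ev d (fun s => ev d (W s))
        - lsum (all_configs n) (fun s => g s * lsum (all_configs n) (fun t => g t * W s t)))
  <= 4 * z * c.
Proof.
  intros Hd Hl Hg Hg1 Htv Hc HW.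
  set (W' := fun s => lsum (all_configs n) (fun t => g t * W s t)).
  assert (HW' : forall s, Rabs (W' s) <= c).
  { intros s. unfold W'. eapply Rle_trans; [apply lsum_abs|].
    rewrite <- (Rmult_1_r c), <- Hg1, <- lsum_scal. apply lsum_le. intros t _.
    rewrite Rabs_mult, (Rabs_right (g t)) by (apply Rle_ge, Hg).
    rewrite Rmult_comm. apply Rmult_le_compat_r; auto. }
  pose proof (ev_tv n d g W' c z Hl Htv Hc HW') as H1.
  assert (H2 : Rabs (ev d (fun s => ev d (W s) + (-1) * W' s)) <= 2 * z * c).
  { apply ev_abs_le; auto. intros [p s] _. simpl.
    replace (ev d (W s) + -1 * W' s) with (ev d (W s) - W' s) by ring.
    apply ev_tv; auto. }
  rewrite ev_plus, ev_scal in H2.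
  change (Rabs (ev d (fun s => ev d (W s))
     - lsum (all_configs n) (fun s => g s * W' s)) <= 4 * z * c).
  set (T := lsum _ (fun s => g s * W' s)) in *.
  replace (ev d (fun s => ev d (W s)) - T)
    with ((ev d (fun s => ev d (W s)) + -1 * ev d W') + (ev d W' - T)) by ring.
  replace (4 * z * c) with (2 * z * c + 2 * z * c) by ring.
  eapply Rle_trans; [apply Rabs_triang|]. apply Rplus_le_compat; assumption.
Qed.

(** Mean value bounds: for [y <= x] the difference [exp x - exp y] lies between [exp y * (x - y)]
    and [exp x * (x - y)], and both slopes lie between [exp (- c)] and [exp c]. *)
Lemma sqr_exp_diff_bounds x y c : Rabs x <= c -> Rabs y <= c ->
  exp (- (2 * c)) * (x - y) ^ 2 <= (exp x - exp y) ^ 2 <= exp (2 * c) * (x - y) ^ 2.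
Proof.
  assert (Main : forall x y, y <= x -> Rabs x <= c -> Rabs y <= c ->
     exp (- (2 * c)) * (x - y) ^ 2 <= (exp x - exp y) ^ 2 <= exp (2 * c) * (x - y) ^ 2).
  { clear x y. intros x y Hxy Hx Hy.
    assert (Hx' : x <= c /\ - c <= y)
      by (revert Hx Hy; unfold Rabs; repeat destruct Rcase_abs; lra).
    assert (L : exp y * (x - y) <= exp x - exp y).
    { replace (exp x) with (exp y * exp (x - y)) by (rewrite <- exp_plus; f_equal; ring).
      pose proof (exp_ineq1_le (x - y)) as H. pose proof (exp_pos y).
      apply (Rmult_le_compat_l (exp y)) in H; lra. }
    assert (U : exp x - exp y <= exp x * (x - y)).
    { replace (exp y) with (exp x * exp (y - x)) by (rewrite <- exp_plus; f_equal; ring).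
      pose proof (exp_ineq1_le (y - x)) as H. pose proof (exp_pos x).
      apply (Rmult_le_compat_l (exp x)) in H; lra. }
    assert (exp (- c) <= exp y) by (apply exp_le_mono; lra).
    assert (exp x <= exp c) by (apply exp_le_mono; lra).
    pose proof (exp_pos (- c)). pose proof (exp_pos x).
    replace (exp (- (2 * c))) with (exp (- c) ^ 2)
      by (simpl; rewrite Rmult_1_r, <- exp_plus; f_equal; ring).
    replace (exp (2 * c)) with (exp c ^ 2)
      by (simpl; rewrite Rmult_1_r, <- exp_plus; f_equal; ring).
    rewrite <- !Rpow_mult_distr. split; apply pow_incr; nra. }
  intros Hx Hy. destruct (Rle_dec y x); [auto|].
  replace ((x - y) ^ 2) with ((y - x) ^ 2) by ring.
  replace ((exp x - exp y) ^ 2) with ((exp y - exp x) ^ 2) by ring.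
  apply Main; auto; lra.
Qed.

(** For a probability [g] this is 8 times the variance of the energy. The inner factor 2 clears the
    [/ 2] of the quadratic form, as the program does. *)
Definition pair_var n J h (g : list bool -> R) : R :=
  lsum (all_configs n) (fun s => g s *
    lsum (all_configs n) (fun t => g t * (2 * (energy n J h s - energy n J h t)) ^ 2)).

(** The energies differ by at most [c] pointwise, hence so do the log-partition functions; half of
    the total [2 * c] remains. *)
Lemma half_llr_abs n J h J' h' s :
  Rabs (half_llr n J h J' h' s)
  <= param_norm n (fun u v => J u v - J' u v) (fun u => h u - h' u).
Proof.
  set (c := param_norm n _ _).
  assert (HE : forall t, Rabs (energy n J h t - energy n J' h' t) <= c)
    by (intros; rewrite energy_sub; apply energy_abs).
  assert (HZ : forall K k K' k',
     (forall t, energy n K k t <= c + energy n K' k' t) ->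
     ln (partition n K k) <= c + ln (partition n K' k')).
  { intros K k K' k' H. pose proof (partition_pos n K k) as P.
    pose proof (partition_pos n K' k') as P'.
    rewrite <- (ln_exp c), <- ln_mult by (auto; apply exp_pos).
    assert (Hle : partition n K k <= exp c * partition n K' k').
    { unfold partition, gweight. rewrite <- lsum_scal. apply lsum_le. intros t _.
      rewrite <- exp_plus. apply exp_le_mono, H. }
    destruct Hle as [Hlt|Heq];
      [left; apply ln_increasing; assumption|rewrite Heq; right; reflexivity]. }
  assert (Z1 := HZ J h J' h'). assert (Z2 := HZ J' h' J h).
  assert (HE1 : forall t, energy n J h t <= c + energy n J' h' t)
    by (intros t; specialize (HE t); revert HE; unfold Rabs; destruct Rcase_abs; lra).
  assert (HE2 : forall t, energy n J' h' t <= c + energy n J h t)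
    by (intros t; specialize (HE t); revert HE; unfold Rabs; destruct Rcase_abs; lra).
  specialize (Z1 HE1). specialize (Z2 HE2). specialize (HE1 s). specialize (HE2 s).
  unfold half_llr, Rabs; destruct Rcase_abs; lra.
Qed.

(** With [Y = exp x] and mean [m], the mean square [VY] of [Y s - Y t] is [2 * D * (1 + m)], about
    [4 * D]. Replacing exponentials by their exponents turns [VY] into [V / 16], since [x s - x t]
    is a quarter of the difference squared in [V]. Hence the factor 64. *)
Lemma hellinger_pair_var n J h J' h' c :
  c = param_norm n (fun u v => J u v - J' u v) (fun u => h u - h' u) ->
  let V := pair_var n (fun u v => J u v - J' u v) (fun u => h u - h' u) (gibbs n J' h') in
  exp (- (4 * c)) * (V / 64) <= hellinger n J h J' h' <= exp (4 * c) * (V / 64).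
Proof.
  intros Hc V.
  set (x := half_llr n J h J' h'). set (mu := gibbs n J' h').
  set (D := hellinger n J h J' h').
  set (m := lsum (all_configs n) (fun s => mu s * exp (x s))).
  assert (Hx : forall s, Rabs (x s) <= c) by (intros; rewrite Hc; apply half_llr_abs).
  assert (Hmu : forall s, 0 < mu s) by (intros; apply gibbs_pos).
  assert (HY2 : lsum (all_configs n) (fun s => mu s * exp (x s) ^ 2) = 1).
  { rewrite <- (gibbs_sum n J h). apply lsum_ext. intros s _. unfold mu.
    rewrite !gibbs_exp. simpl. rewrite Rmult_1_r, <- !exp_plus. f_equal.
    unfold x, half_llr. lra. }
  assert (Hmu1 : lsum (all_configs n) mu = 1) by apply gibbs_sum.
  assert (HD : D = 1 - m).
  { unfold D, m. rewrite hellinger_affinity. f_equal. apply lsum_ext. intros s _.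
    unfold mu. rewrite gibbs_exp, <- exp_plus. f_equal. unfold x, half_llr. lra. }
  assert (HD0 : 0 <= D) by apply hellinger_nonneg.
  assert (Hm : exp (- c) <= m).
  { rewrite <- (Rmult_1_r (exp (- c))), <- Hmu1, <- lsum_scal. apply lsum_le. intros s _.
    rewrite Rmult_comm. apply Rmult_le_compat_l; [apply Rlt_le, Hmu|].
    apply exp_le_mono. specialize (Hx s). revert Hx; unfold Rabs; destruct Rcase_abs; lra. }
  assert (Hc0 : 0 <= c) by (specialize (Hx nil); pose proof (Rabs_pos (x nil)); lra).
  assert (Hec : exp (- c) <= 1) by (rewrite <- exp_0; apply exp_le_mono; lra).
  pose proof (exp_pos (- c)) as Hpc.
  set (VY := lsum (all_configs n) (fun s => mu s *
       lsum (all_configs n) (fun t => mu t * (exp (x s) - exp (x t)) ^ 2))).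
  assert (HVY : VY = 2 * (D * (1 + m))).
  { transitivity (2 - 2 * m ^ 2); [|rewrite HD; ring].
    unfold VY.
    rewrite (lsum_ext _ _ (fun s => mu s * exp (x s) ^ 2
                + (mu s * 1 + (- 2 * m) * (mu s * exp (x s))))).
    - rewrite !lsum_plus, lsum_scal, HY2.
      rewrite (lsum_ext _ (fun a => mu a * 1) mu) by (intros; ring).
      rewrite Hmu1. fold m. ring.
    - intros s _.
      rewrite (lsum_ext _ _ (fun t => exp (x s) ^ 2 * mu t
                + (mu t * exp (x t) ^ 2 + (- 2 * exp (x s)) * (mu t * exp (x t)))))
        by (intros; ring).
      rewrite !lsum_plus, !lsum_scal, HY2, Hmu1. fold m. ring. }
  assert (Hxd : forall s t, (x s - x t) ^ 2
      = / 16 * (2 * (energy n (fun u v => J u v - J' u v) (fun u => h u - h' u) s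
             - energy n (fun u v => J u v - J' u v) (fun u => h u - h' u) t)) ^ 2).
  { intros s t. rewrite <- !energy_sub. unfold x, half_llr. field. }
  assert (HV : forall k, k * (V / 16) = lsum (all_configs n) (fun s => mu s *
       lsum (all_configs n) (fun t => mu t * (k * (x s - x t) ^ 2)))).
  { intros k. unfold V, pair_var. fold mu.
    replace (k * (_ / 16)) with (k * / 16 * lsum (all_configs n) (fun s => mu s *
    lsum (all_configs n) (fun t => mu t *
     (2 * (energy n (fun u v => J u v - J' u v) (fun u => h u - h' u) s
             - energy n (fun u v => J u v - J' u v) (fun u => h u - h' u) t)) ^ 2)))
      by (unfold Rdiv; ring).
    rewrite <- lsum_scal. apply lsum_ext. intros s _.
    rewrite (Rmult_comm (mu s)), <- Rmult_assoc, <- lsum_scal, (Rmult_comm (mu s)).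
    f_equal. apply lsum_ext. intros t _. rewrite Hxd. ring. }
  assert (Hlo : exp (- (2 * c)) * (V / 16) <= VY).
  { rewrite HV. apply lsum_le. intros s _. apply Rmult_le_compat_l; [apply Rlt_le, Hmu|].
    apply lsum_le. intros t _. apply Rmult_le_compat_l; [apply Rlt_le, Hmu|].
    apply sqr_exp_diff_bounds; auto. }
  assert (Hup : VY <= exp (2 * c) * (V / 16)).
  { rewrite HV. apply lsum_le. intros s _. apply Rmult_le_compat_l; [apply Rlt_le, Hmu|].
    apply lsum_le. intros t _. apply Rmult_le_compat_l; [apply Rlt_le, Hmu|].
    apply sqr_exp_diff_bounds; auto. }
  assert (HV0 : 0 <= V).
  { unfold V, pair_var. apply lsum_nonneg. intros s _.
    apply Rmult_le_pos; [apply Rlt_le, gibbs_pos|]. apply lsum_nonneg. intros t _.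
    apply Rmult_le_pos; [apply Rlt_le, gibbs_pos|apply pow2_ge_0]. }
  assert (exp (- (4 * c)) <= exp (- (2 * c))) by (apply exp_le_mono; lra).
  (* Comparing exponentials costs [2 * c] in the exponent, and [1 + m >= 2 * exp (- c)] costs
     another [c]; the total is rounded up to [4 * c]. *)
  assert (E3 : exp c * exp (2 * c) <= exp (4 * c))
    by (rewrite <- exp_plus; apply exp_le_mono; lra).
  assert (E1 : exp c * exp (- c) = 1) by (rewrite <- exp_plus, <- exp_0; f_equal; ring).
  pose proof (exp_pos c). pose proof (exp_pos (2 * c)).
  split.
  - assert (D * (1 + m) <= D * 2) by (apply Rmult_le_compat_l; lra). nra.
  - assert (D * (2 * exp (- c)) <= D * (1 + m)) by (apply Rmult_le_compat_l; lra).
    assert (4 * (D * exp (- c)) <= exp (2 * c) * (V / 16)) by lra.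
    assert (4 * D <= exp c * (exp (2 * c) * (V / 16))).
    { replace (4 * D) with (exp c * (4 * (D * exp (- c)))).
      - apply Rmult_le_compat_l; lra.
      - transitivity (4 * D * (exp c * exp (- c))); [ring|rewrite E1; ring]. }
    assert (exp c * exp (2 * c) * (V / 16) <= exp (4 * c) * (V / 16))
      by (apply Rmult_le_compat_r; lra).
    lra.
Qed.

(** * The program *)

(** The deterministic, non-halting instructions occurring in [hellinger_prog], gathered so that the
    single rule [good_step] handles them all. *)
Definition dstep (I : instance) (ins : instr) (pc : nat) (rr : nat -> R) (nr : nat -> nat)
  : option (nat * (nat -> R) * (nat -> nat)) :=
  let nx := S pc in
  match ins with
  | IJmp l => Some (l, rr, nr)
  | IJltR a b l => Some (if Rlt_dec (rr a) (rr b) then l else nx, rr, nr)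
  | IJltN a b l => Some (if Nat.ltb (nr a) (nr b) then l else nx, rr, nr)
  | IRofN d a => Some (nx, updR rr d (INR (nr a)), nr)
  | IRAdd d a b => Some (nx, updR rr d (rr a + rr b), nr)
  | IRSub d a b => Some (nx, updR rr d (rr a - rr b), nr)
  | IRMul d a b => Some (nx, updR rr d (rr a * rr b), nr)
  | IRDiv d a b => Some (nx, updR rr d (rr a / rr b), nr)
  | IRSqrt d a => Some (nx, updR rr d (sqrt (rr a)), nr)
  | IRLoad d a => Some (nx, updR rr d (rr (nr a)), nr)
  | INConst d k => Some (nx, rr, updN nr d k)
  | INAdd d a b => Some (nx, rr, updN nr d (nr a + nr b)%nat)
  | IReadN d => Some (nx, rr, updN nr d (inst_n I))
  | IReadJ m d u v =>
      Some (nx, updR rr d ((if m then J_nu I else J_mu I) (nr u) (nr v)), nr)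
  | IReadH m d u => Some (nx, updR rr d ((if m then h_nu I else h_mu I) (nr u)), nr)
  | _ => None
  end.

(** * Proof rules for running time and success probability *)

Section ProgramLogic.

Variables (prog : list instr) (I : instance) (o : oracles) (Q : outcome -> bool) (K : nat).

(* [K] bounds the cost of every single instruction executed, oracle calls included, so
   that [j] counts instructions. *)
Definition good (j : nat) (p : R) (pc : nat) (rr : nat -> R) (nr : nat -> nat) : Prop :=
  forall fuel budget, (j * K <= budget)%nat -> (budget <= fuel)%nat ->
    prob (exec prog I o fuel budget pc rr nr) is_timeout = 0
    /\ p <= prob (exec prog I o fuel budget pc rr nr) Q.

Lemma good_mono j j' p p' pc rr nr :
  good j p pc rr nr -> (j <= j')%nat -> p' <= p -> good j' p' pc rr nr.
Proof.
  intros H Hj Hp f bud Hb Hf. destruct (H f bud) as [H1 H2]; [nia|assumption|].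
  split; [assumption|lra].
Qed.

Lemma icost_pos ins rr nr : (1 <= icost o ins rr nr)%nat.
Proof. destruct ins; simpl; lia. Qed.

(** One instruction takes at most [K] from the budget, which leaves enough for [j] more. It takes at
    least 1, so the budget stays below the fuel. *)
Lemma good_step ins pc' rr' nr' j p pc rr nr :
  nth_error prog pc = Some ins -> dstep I ins pc rr nr = Some (pc', rr', nr') ->
  (icost o ins rr nr <= K)%nat -> good j p pc' rr' nr' -> good (S j) p pc rr nr.
Proof.
  intros Hins Hd Hc H f bud Hb Hf.
  pose proof (icost_pos ins rr nr) as Hpos. simpl in Hb.
  destruct f as [|f]; [lia|].
  assert (Hlt : Nat.ltb bud (icost o ins rr nr) = false) by (apply Nat.ltb_ge; lia).
  specialize (H f (bud - icost o ins rr nr)%nat ltac:(lia) ltac:(lia)).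
  cbn [exec]. rewrite Hins. cbv zeta. rewrite Hlt.
  destruct ins; simpl in Hd; try discriminate Hd; injection Hd as <- <- <-;
    try exact H; [destruct (Rlt_dec _ _)|destruct (Nat.ltb _ _)]; exact H.
Qed.

Lemma good_halt r j p pc rr nr :
  nth_error prog pc = Some (IHalt r) -> (1 <= K)%nat ->
  p <= (if Q (Halted (rr r)) then 1 else 0) -> good (S j) p pc rr nr.
Proof.
  intros Hins HK Hp f bud Hb Hf. simpl in Hb. destruct f as [|f]; [lia|].
  cbn [exec]. rewrite Hins. cbv zeta.
  replace (Nat.ltb bud _) with false by (symmetry; apply Nat.ltb_ge; simpl; lia).
  unfold prob, lsum; simpl. split; [lra|]. destruct (Q _); lra.
Qed.

(** The success bound [F] may depend on the oracle's answer and may be negative; nested calls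
    produce nested expectations. *)
Lemma good_dbind {X} (d : dist X) (f : X -> dist outcome) F :
  is_dist d ->
  (forall pa, In pa d -> prob (f (snd pa)) is_timeout = 0 /\ F (snd pa) <= prob (f (snd pa)) Q) ->
  prob (dbind d f) is_timeout = 0 /\ ev d F <= prob (dbind d f) Q.
Proof.
  intros Hd H. rewrite !prob_dbind. split.
  - rewrite (ev_ext d _ (fun _ => 0)); [apply ev_const; assumption|]. apply H.
  - apply ev_le; [assumption|]. apply H.
Qed.

Lemma good_sample a e F j pc rr nr :
  nth_error prog pc = Some (ISample a e) -> 0 < rr e -> is_dist (samp o (rr e)) ->
  (S (samp_cost o (rr e)) <= K)%nat ->
  (forall pa, In pa (samp o (rr e)) ->
     good j (F (snd pa)) (S pc) (write_cfg rr (nr a) (snd pa)) nr) ->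
  good (S j) (ev (samp o (rr e)) F) pc rr nr.
Proof.
  intros Hins He Hd Hc H f bud Hb Hf. simpl in Hb. destruct f as [|f]; [lia|].
  cbn [exec]. rewrite Hins. cbv zeta.
  replace (Nat.ltb bud _) with false by (symmetry; apply Nat.ltb_ge; simpl; lia).
  destruct (Rle_dec (rr e) 0); [lra|].
  apply good_dbind; [assumption|]. intros pa Hpa. apply H; simpl; (assumption || lia).
Qed.

Lemma good_count m d e F j pc rr nr :
  nth_error prog pc = Some (ICount m d e) -> 0 < rr e -> is_dist (cnt o m (rr e)) ->
  (S (cnt_cost o m (rr e)) <= K)%nat ->
  (forall z, good j (F z) (S pc) (updR rr d z) nr) ->
  good (S j) (ev (cnt o m (rr e)) F) pc rr nr.
Proof.
  intros Hins He Hd Hc H f bud Hb Hf. simpl in Hb. destruct f as [|f]; [lia|].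
  cbn [exec]. rewrite Hins. cbv zeta.
  replace (Nat.ltb bud _) with false by (symmetry; apply Nat.ltb_ge; simpl; lia).
  destruct (Rle_dec (rr e) 0); [lra|].
  apply good_dbind; [assumption|]. intros pa Hpa. apply H; simpl; lia.
Qed.

(** The rule is in continuation style: the body must lead back to the loop head. Each round costs
    one test and [jb] instructions, the exit a failed test and a jump. The bound on [K] pays for
    comparing indices, which is charged by bit length. *)
Lemma good_for (Inv : nat -> (nat -> R) -> (nat -> nat) -> Prop) n pc i ex jb j p :
  nth_error prog pc = Some (IJltN i 0 (S (S pc))) ->
  nth_error prog (S pc) = Some (IJmp ex) ->
  (2 * n + 1 <= K)%nat ->
  (forall k rr nr, Inv k rr nr -> nr i = k /\ nr 0%nat = n) ->
  (forall k j rr nr, (k < n)%nat -> Inv k rr nr ->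
     (forall rr' nr', Inv (S k) rr' nr' -> good j p pc rr' nr') ->
     good (jb + j) p (S (S pc)) rr nr) ->
  (forall rr nr, Inv n rr nr -> good j p ex rr nr) ->
  forall rr nr, Inv 0%nat rr nr -> good (n * S jb + (2 + j)) p pc rr nr.
Proof.
  intros H1 H2 HK Hi Hbody Hex rr nr H0.
  assert (Main : forall m k rr nr, (k + m = n)%nat -> Inv k rr nr ->
            good (m * S jb + (2 + j)) p pc rr nr).
  { clear rr nr H0. induction m as [|m IH]; intros k rr nr Hk H;
      destruct (Hi _ _ _ H) as [Hik Hn].
    - eapply good_step; [exact H1|reflexivity| |].
      + cbn [icost]. pose proof (Nat.log2_le_lin (nr i + nr 0)%nat (Nat.le_0_l _)). lia.
      + rewrite Hik, Hn. replace (Nat.ltb k n) with false by (symmetry; apply Nat.ltb_ge; lia).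
        eapply good_step; [exact H2|reflexivity|simpl; lia|].
        apply Hex. replace n with k by lia. assumption.
    - replace (S m * S jb + (2 + j))%nat with (S (jb + (m * S jb + (2 + j)))) by lia.
      eapply good_step; [exact H1|reflexivity| |].
      + cbn [icost]. pose proof (Nat.log2_le_lin (nr i + nr 0)%nat (Nat.le_0_l _)). lia.
      + rewrite Hik, Hn. replace (Nat.ltb k n) with true by (symmetry; apply Nat.ltb_lt; lia).
        apply Hbody with k; [lia|assumption|].
        intros; apply (IH (S k)); [lia|assumption]. }
  apply (Main n 0%nat); auto.
Qed.

End ProgramLogic.

(* The parameter [c] is [64 * B] with [/ B <= b].  Natural registers: 0 holds [n], 1 holds 1,
   2 and 3 are loop indices, 4 and 5 are the base addresses of the two samples.  Real
   registers: 0 is [e = min (eps, 1)], 4 is [delta], 5 is the oracle accuracy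
   [eta = (e / ((n + 1) * c)) ^ 4], 8 counts sample pairs up to the bound in 10 (kept as a
   real since the machine cannot round), 9 accumulates [(2 * (G s - G t)) ^ 2].  Instruction
   27 follows the computation of [delta], 48 heads the sampling loop, 52 computes
   [2 * (G s - G t)] for one pair, and 95 starts the counting branch. *)
Definition hellinger_prog (c : nat) : list instr := [
  IReadN 0; INConst 1 1; IRofN 1 1; IJltR 0 1 5; IRMul 0 1 1; IRSub 4 1 1;
  IJltN 2 0 8; IJmp 27;
    IReadH true 2 2; IReadH false 3 2; IRSub 2 2 3; IRMul 2 2 2; IRSqrt 2 2; IRAdd 4 4 2;
    INConst 3 0;
    IJltN 3 0 17; IJmp 25;
      IReadJ true 2 2 3; IReadJ false 3 2 3; IRSub 2 2 3; IRMul 2 2 2; IRSqrt 2 2;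
      IRAdd 4 4 2; INAdd 3 3 1; IJmp 15;
    INAdd 2 2 1; IJmp 6;
  INAdd 5 0 1; IRofN 5 5; INConst 4 c; IRofN 6 4; IRMul 5 5 6; IRDiv 5 0 5;
  IRMul 5 5 5; IRMul 5 5 5;
  INConst 4 8; IRofN 6 4; IRDiv 6 0 6; IRSub 7 1 1;
  IJltR 7 4 41; IHalt 7;
  IJltR 6 4 95;
  IRSub 8 1 1; IRSub 9 1 1; IRMul 10 5 5; IRDiv 10 1 10; INConst 4 20; INAdd 5 4 0;
  IJltR 8 10 50; IJmp 90;
    ISample 4 5; ISample 5 5; IRSub 11 1 1; INConst 2 0;
    IJltN 2 0 56; IJmp 86;
      INAdd 6 4 2; IRLoad 12 6; INAdd 6 5 2; IRLoad 13 6;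
      IReadH true 2 2; IReadH false 3 2; IRSub 2 2 3; IRSub 3 12 13; IRMul 2 2 3;
      IRAdd 2 2 2; IRAdd 11 11 2; INConst 3 0;
      IJltN 3 0 70; IJmp 84;
        INAdd 6 4 3; IRLoad 14 6; INAdd 6 5 3; IRLoad 15 6;
        IRMul 14 12 14; IRMul 15 13 15; IRSub 14 14 15;
        IReadJ true 2 2 3; IReadJ false 3 2 3; IRSub 2 2 3; IRMul 2 2 14; IRAdd 11 11 2;
        INAdd 3 3 1; IJmp 68;
      INAdd 2 2 1; IJmp 54;
    IRMul 11 11 11; IRAdd 9 9 11; IRAdd 8 8 1; IJmp 48;
  INConst 4 64; IRofN 6 4; IRMul 8 8 6; IRDiv 9 9 8; IHalt 9;
  ICount MNu 6 5; ICount MMu 7 5; ICount MAvg 8 5;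
  IRMul 6 6 7; IRSqrt 6 6; IRDiv 8 8 6; IRSub 8 1 8; IHalt 8 ].

Arguments updR f d x i /.
Arguments updN f d x i /.

Lemma S_log2_le a k : (S a <= k)%nat -> (S (Nat.log2 a) <= k)%nat.
Proof. pose proof (Nat.log2_le_lin a (Nat.le_0_l a)). lia. Qed.

Ltac cost :=
  cbn [icost]; try apply S_log2_le; cbn [updN updR Nat.eqb Nat.add]; lia.

Ltac step := eapply good_step;
  [reflexivity|reflexivity|cost|cbn [updR updN Nat.eqb Nat.add]].

(** * Verification of the stages of the program *)

Section Program.

Variables (c : nat) (I : instance) (o : oracles) (Q : outcome -> bool) (K : nat).
Let n := inst_n I.
Hypothesis K_large : (2 * n + 50 <= K)%nat.

Let dJ u v := J_nu I u v - J_mu I u v.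
Let dh u := h_nu I u - h_mu I u.
Let good := good (hellinger_prog c) I o Q K.

Lemma sqrt_mul_self x : sqrt (x * x) = Rabs x.
Proof. apply sqrt_Rsqr_abs. Qed.

(** Both loops keep the partial sum in real register 4, with absolute values computed as
    [sqrt (x * x)]. In the count, 7 precedes the inner loop, 9 is an inner round with its test, and
    4 is the inner exit followed by the outer increment and jump. *)
Lemma good_param_norm e j p :
  (forall rr nr, nr 0%nat = n -> nr 1%nat = 1%nat -> rr 0%nat = e -> rr 1%nat = 1 ->
     rr 4%nat = param_norm n dJ dh -> good j p 27 rr nr) ->
  forall rr nr, nr 0%nat = n -> nr 1%nat = 1%nat -> nr 2%nat = 0%nat ->
    rr 0%nat = e -> rr 1%nat = 1 -> rr 4%nat = 0 ->
    good (n * S (7 + (n * 9 + 4)) + (2 + j)) p 6 rr nr.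
Proof.
  intros Hex rr nr N0 N1 N2 R0 R1 R4.
  apply good_for with (ex := 27%nat) (i := 2%nat)
    (Inv := fun k rr nr => nr 2%nat = k /\ nr 0%nat = n /\ nr 1%nat = 1%nat
       /\ rr 0%nat = e /\ rr 1%nat = 1
       /\ rr 4%nat = rsum k (fun u => Rabs (dh u) + rsum n (fun v => Rabs (dJ u v))));
    [reflexivity|reflexivity|lia|tauto| | |auto 6].
  2:{ clear - Hex. intros rr nr (N2 & N0 & N1 & R0 & R1 & R4). apply Hex; auto. }
  clear - K_large. intros u j' rr nr Hu (N2 & N0 & N1 & R0 & R1 & R4) Hnext.
  replace (7 + (n * 9 + 4) + j')%nat with (7 + (n * 9 + (2 + (2 + j'))))%nat by lia.
  cbn [Nat.add]. do 7 step. rewrite sqrt_mul_self, N2.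
  apply good_for with (ex := 25%nat) (i := 3%nat)
    (Inv := fun k rr nr => nr 3%nat = k /\ nr 0%nat = n /\ nr 1%nat = 1%nat /\ nr 2%nat = u
       /\ rr 0%nat = e /\ rr 1%nat = 1
       /\ rr 4%nat = rsum u (fun u => Rabs (dh u) + rsum n (fun v => Rabs (dJ u v)))
            + Rabs (dh u) + rsum k (fun v => Rabs (dJ u v)));
    [reflexivity|reflexivity|lia|tauto| | |].
  - clear - K_large Hu. intros v j rr nr Hv (N3 & N0 & N1 & N2 & R0 & R1 & R4) Hnext.
    do 8 step. rewrite sqrt_mul_self, N2, N3. apply Hnext. cbn.
    rewrite N1, R4. unfold dJ. repeat split; auto; lia || lra.
  - clear - K_large Hnext Hu. intros rr nr (N3 & N0 & N1 & N2 & R0 & R1 & R4).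
    do 2 step. apply Hnext. cbn. rewrite N1, N2, R4. repeat split; auto; lia || lra.
  - cbn. rewrite R4. unfold dh. repeat split; auto; lra.
Qed.


(** The order of summation of the program; doubling clears the [/ 2] of the couplings and makes the
    field term appear twice. *)
Lemma energy_pair_sum s t :
  2 * (energy n dJ dh s - energy n dJ dh t)
  = rsum n (fun u => (dh u * (sp s u - sp t u) + dh u * (sp s u - sp t u))
      + rsum n (fun v => dJ u v * (sp s u * sp s v - sp t u * sp t v))).
Proof.
  unfold energy. rewrite !rsum_plus.
  rewrite (rsum_ext n (fun u => dh u * (sp s u - sp t u))
             (fun u => dh u * sp s u + (-1) * (dh u * sp t u))) by (intros; ring).
  rewrite (rsum_ext n (fun u => rsum n (fun v => dJ u v * (sp s u * sp s v - sp t u * sp t v)))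
             (fun u => rsum n (fun v => dJ u v * sp s u * sp s v)
                + (-1) * rsum n (fun v => dJ u v * sp t u * sp t v))).
  - rewrite !rsum_plus, !rsum_scal. lra.
  - intros u _. rewrite <- rsum_scal, <- rsum_plus. apply rsum_ext. intros; ring.
Qed.

(** What holds at the head of the sampling loop. Samples are stored from address 20 upwards, above
    every real register that the program names. *)
Definition loop_state (eta k acc bound : R) (rr : nat -> R) (nr : nat -> nat) : Prop :=
  nr 0%nat = n /\ nr 1%nat = 1%nat /\ nr 4%nat = 20%nat /\ nr 5%nat = (20 + n)%nat
  /\ rr 1%nat = 1 /\ rr 5%nat = eta /\ rr 8%nat = k /\ rr 9%nat = acc /\ rr 10%nat = bound.

Definition stored (s t : list bool) (rr : nat -> R) : Prop :=
  forall u, (u < n)%nat -> rr (20 + u)%nat = sp s u /\ rr (20 + n + u)%nat = sp t u.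

Lemma good_energy_pair eta k acc bound s t j p :
  (forall rr nr, loop_state eta k acc bound rr nr ->
     rr 11%nat = 2 * (energy n dJ dh s - energy n dJ dh t) -> good j p 86 rr nr) ->
  forall rr nr, loop_state eta k acc bound rr nr -> stored s t rr ->
    good (2 + (n * S (12 + (n * 15 + 4)) + (2 + j))) p 52 rr nr.
Proof.
  intros Hex rr nr (N0 & N1 & N4 & N5 & R1 & R5 & R8 & R9 & R10) Hst.
  cbn [Nat.add]. do 2 step.
  apply good_for with (ex := 86%nat) (i := 2%nat)
    (Inv := fun u rr nr => nr 2%nat = u /\ nr 0%nat = n
       /\ loop_state eta k acc bound rr nr /\ stored s t rr
       /\ rr 11%nat = rsum u (fun u => (dh u * (sp s u - sp t u) + dh u * (sp s u - sp t u))
           + rsum n (fun v => dJ u v * (sp s u * sp s v - sp t u * sp t v))));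
    [reflexivity|reflexivity|lia|tauto| | |].
  - clear - K_large. intros u j' rr nr Hu
      (N2 & _ & (N0 & N1 & N4 & N5 & R1 & R5 & R8 & R9 & R10) & Hst & R11) Hnext.
    destruct (Hst u Hu) as [Hs Ht]. cbn [Nat.add] in Hs, Ht.
    apply good_mono with (j := (12 + (n * 15 + (2 + (2 + j'))))%nat) (p := p); [|lia|lra].
    cbn [Nat.add]. step. rewrite N4, N2. cbn [Nat.add]. step. rewrite Hs.
    step. rewrite N5, N2. cbn [Nat.add]. step. rewrite Ht.
    do 8 step. rewrite N2.
    apply good_for with (ex := 84%nat) (i := 3%nat)
      (Inv := fun v rr nr => nr 3%nat = v /\ nr 0%nat = n /\ nr 2%nat = u
         /\ loop_state eta k acc bound rr nr /\ stored s t rr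
         /\ rr 12%nat = sp s u /\ rr 13%nat = sp t u
         /\ rr 11%nat = rsum u (fun u => (dh u * (sp s u - sp t u) + dh u * (sp s u - sp t u))
             + rsum n (fun v => dJ u v * (sp s u * sp s v - sp t u * sp t v)))
             + (dh u * (sp s u - sp t u) + dh u * (sp s u - sp t u))
             + rsum v (fun v => dJ u v * (sp s u * sp s v - sp t u * sp t v)));
      [reflexivity|reflexivity|lia|tauto| | |].
    + clear - K_large Hu. intros v j rr nr Hv
        (N3 & _ & N2 & (N0 & N1 & N4 & N5 & R1 & R5 & R8 & R9 & R10) & Hst
          & R12 & R13 & R11) Hnext.
      destruct (Hst v Hv) as [Hs Ht]. cbn [Nat.add] in Hs, Ht.
      cbn [Nat.add]. step. rewrite N4, N3. cbn [Nat.add]. step. rewrite Hs.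
      step. rewrite N5, N3. cbn [Nat.add]. step. rewrite Ht.
      do 10 step. rewrite N2, N3. apply Hnext. unfold loop_state, stored. cbn.
      rewrite N1, R11, R12, R13. unfold dJ. repeat split; auto; try lia; try lra;
        apply Hst; assumption.
    + clear - K_large Hnext Hu. intros rr nr (N3 & _ & N2
         & (N0 & N1 & N4 & N5 & R1 & R5 & R8 & R9 & R10) & Hst & R12 & R13 & R11).
      do 2 step. apply Hnext. unfold loop_state, stored. cbn. rewrite N1, N2, R11.
      repeat split; auto; try lia; try lra; apply Hst; assumption.
    + unfold loop_state, stored. cbn. rewrite R11. unfold dh.
      repeat split; auto; try lra; apply Hst; assumption.
  - clear - Hex. intros rr nr (N2 & N0 & HS & Hst & R11). apply Hex; [assumption|].
    rewrite R11, energy_pair_sum. reflexivity.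
  - unfold loop_state, stored. cbn. repeat split; auto; try lra; apply Hst; assumption.
Qed.


Lemma write_cfg_low rr base s r : (r < base)%nat -> write_cfg rr base s r = rr r.
Proof.
  intros H. unfold write_cfg. replace (Nat.leb base r) with false; [reflexivity|].
  symmetry. apply Nat.leb_gt. assumption.
Qed.

Lemma write_cfg_at rr base s u :
  (u < length s)%nat -> write_cfg rr base s (base + u)%nat = sp s u.
Proof.
  intros H. unfold write_cfg, sp.
  replace (Nat.leb base (base + u)) with true by (symmetry; apply Nat.leb_le; lia).
  replace (Nat.ltb (base + u) (base + length s)) with true
    by (symmetry; apply Nat.ltb_lt; lia).
  simpl. do 2 f_equal. lia.
Qed.

(* One round of the sampling loop in Chebyshev's inequality: the expected square grows by
   at most [v], so the bound can be carried as the loop invariant. *)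
Lemma ev2_quadratic (d : dist (list bool)) W A m v tau :
  is_dist d -> 0 < tau -> ev d (fun s => ev d (fun t => W s t ^ 2)) <= v ->
  1 - ((A + ev d (fun s => ev d (W s))) ^ 2 + (m + 1) * v) / tau ^ 2
  <= ev d (fun s => ev d (fun t => 1 - ((W s t + A) ^ 2 + m * v) / tau ^ 2)).
Proof.
  intros Hd Htau Hv.
  assert (Hin : forall s, ev d (fun t => 1 - ((W s t + A) ^ 2 + m * v) / tau ^ 2)
     = (1 - (A ^ 2 + m * v) / tau ^ 2)
       + ((- (2 * A / tau ^ 2)) * ev d (W s) + (- / tau ^ 2) * ev d (fun t => W s t ^ 2))).
  { intros s. rewrite <- (ev_const d (1 - (A ^ 2 + m * v) / tau ^ 2)) by assumption.
    rewrite <- !ev_scal, <- !ev_plus. apply ev_ext. intros pa _. field. lra. }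
  eapply Rle_trans; [|right; symmetry; exact (ev_ext d _ (fun s =>
     (1 - (A ^ 2 + m * v) / tau ^ 2)
       + ((- (2 * A / tau ^ 2)) * ev d (W s) + (- / tau ^ 2) * ev d (fun t => W s t ^ 2)))
     (fun pa _ => Hin (snd pa)))].
  rewrite !ev_plus, !ev_scal, ev_const by assumption.
  set (w := ev d (fun s => ev d (W s))).
  set (w2 := ev d (fun a => ev d (fun t => W a t ^ 2))) in *.
  assert (Ht : 0 < / tau ^ 2) by (apply Rinv_0_lt_compat; nra).
  unfold Rdiv. set (y := / tau ^ 2) in *.
  (* After expansion the two sides differ by exactly this quantity. *)
  assert (0 <= y * (w ^ 2 + (v - w2))).
  { pose proof (pow2_ge_0 w). apply Rmult_le_pos; lra. }
  lra.
Qed.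

(** Chebyshev's inequality by induction on the rounds left. The bound at accumulator [acc] with [m]
    rounds left is the displayed one with [acc + m * w] as expected final sum; [ev2_quadratic]
    carries it through a round. The condition on [M] makes it the exact number of rounds. *)
Lemma good_sampling eta (W := fun s t => (2 * (energy n dJ dh s - energy n dJ dh t)) ^ 2)
    (w := ev (samp o eta) (fun s => ev (samp o eta) (W s))) M bound tau v a :
  0 < eta -> is_dist (samp o eta) ->
  Forall (fun pa => length (snd pa) = n) (samp o eta) ->
  (S (samp_cost o eta) <= K)%nat ->
  bound <= INR M < bound + 1 -> 0 < tau ->
  ev (samp o eta) (fun s => ev (samp o eta) (fun t => W s t ^ 2)) <= v ->
  (forall acc, (acc - a) ^ 2 <= tau ^ 2 -> Q (Halted (acc / (INR M * 64))) = true) ->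
  forall rr nr, loop_state eta 0 0 bound rr nr ->
  good (M * (11 + n * S (12 + (n * 15 + 4))) + 7)
       (1 - ((INR M * w - a) ^ 2 + INR M * v) / tau ^ 2) 48 rr nr.
Proof.
  intros Heta Hd Hlen Hcost HM Htau Hv HQ.
  assert (Htau2 : 0 < tau ^ 2) by (apply pow_lt; assumption).
  set (E := (n * S (12 + (n * 15 + 4)))%nat).
  assert (Main : forall m k acc rr nr, (k + m = M)%nat ->
     loop_state eta (INR k) acc bound rr nr ->
     good (m * (11 + E) + 7)
       (1 - ((acc + INR m * w - a) ^ 2 + INR m * v) / tau ^ 2) 48 rr nr).
  { induction m as [|m IH]; intros k acc rr nr Hk HS;
      pose proof HS as (N0 & N1 & N4 & N5 & R1 & R5 & R8 & R9 & R10).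
    - replace (0 * (11 + E) + 7)%nat with 7%nat by lia.
      assert (k = M) by lia. subst k.
      step. rewrite R8, R10. destruct (Rlt_dec (INR M) bound); [lra|].
      do 5 step. rewrite R8, R9. eapply good_halt; [reflexivity|lia|].
      cbn [updR Nat.eqb]. replace (INR 64) with 64 by (simpl; lra).
      (* With no round left the bound is at most 1, and at most 0 when [acc] misses [a] by more than
         [tau]. *)
      destruct (Rle_dec ((acc - a) ^ 2) (tau ^ 2)) as [L|L].
      + rewrite HQ by assumption. simpl INR.
        assert (0 <= ((acc + 0 * w - a) ^ 2 + 0 * v) / tau ^ 2).
        { replace ((acc + 0 * w - a) ^ 2 + 0 * v) with ((acc - a) ^ 2) by ring.
          apply Rmult_le_pos; [apply pow2_ge_0|]. apply Rlt_le, Rinv_0_lt_compat; assumption. }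
        lra.
      + apply Rnot_le_lt in L. apply Rle_trans with 0; [|destruct (Q _); lra].
        simpl INR. replace ((acc + 0 * w - a) ^ 2 + 0 * v) with ((acc - a) ^ 2) by ring.
        assert (Hi : 0 < / tau ^ 2) by (apply Rinv_0_lt_compat; assumption).
        assert (tau ^ 2 * / tau ^ 2 = 1) by (apply Rinv_r; lra).
        unfold Rdiv. pose proof (Rmult_lt_compat_r _ _ _ Hi L). lra.
    - assert (Hb : INR k < bound).
      { assert (INR k <= INR M - 1); [|lra].
        replace (INR M) with (INR (k + m) + 1) by (rewrite <- S_INR; f_equal; lia).
        rewrite plus_INR. pose proof (pos_INR m). lra. }
      apply good_mono with
        (j := S (S (S (2 + (E + (2 + S (S (S (S (m * (11 + E) + 7)))))))))%nat)
        (p := ev (samp o eta) (fun s => ev (samp o eta) (fun t =>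
                1 - ((W s t + (acc + INR m * w - a)) ^ 2 + INR m * v) / tau ^ 2)));
        [|lia|].
      2:{ rewrite S_INR. replace (acc + (INR m + 1) * w - a)
            with (acc + INR m * w - a + w) by ring.
          apply ev2_quadratic; assumption. }
      step. rewrite R8, R10. destruct (Rlt_dec (INR k) bound); [|lra].
      rewrite <- R5. rewrite Forall_forall in Hlen.
      eapply good_sample; [reflexivity|lra|rewrite R5; assumption|rewrite R5; assumption|].
      rewrite R5. intros [q s] Hs. specialize (Hlen _ Hs) as Ls. simpl in Ls. cbn [snd].
      rewrite N4.
      (* Storing the first sample leaves the accuracy in register 5 intact for the second call. *)
      assert (L5 : write_cfg rr 20 s 5 = eta) by (rewrite write_cfg_low by lia; assumption).
      rewrite <- L5 at 1.
      eapply good_sample;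
        [reflexivity|lra|rewrite L5; assumption|rewrite L5; assumption|].
      rewrite L5. intros [q' t] Ht. specialize (Hlen _ Ht) as Lt. simpl in Lt. cbn [snd].
      rewrite N5.
      apply good_energy_pair with (eta := eta) (k := INR k) (acc := acc) (bound := bound)
        (s := s) (t := t).
      + intros rr' nr' (N0' & N1' & N4' & N5' & R1' & R5' & R8' & R9' & R10') R11'.
        do 4 step. rewrite R1', R8', R9', R11'.
        eapply good_mono; [apply (IH (S k) (acc + W s t))|lia|].
        * lia.
        * unfold loop_state. cbn [updR Nat.eqb]. rewrite S_INR. unfold W.
          repeat split; auto. ring.
        * right. do 4 f_equal. ring.
      + unfold loop_state. repeat rewrite write_cfg_low by lia. repeat split; assumption.
      + intros u Hu. split.
        * rewrite write_cfg_low by lia. apply write_cfg_at; lia.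
        * apply write_cfg_at; lia. }
  intros rr nr HS. replace (INR M * w - a) with (0 + INR M * w - a) by ring.
  apply Main with 0%nat; [lia|exact HS].
Qed.


(** Union bound: success is at least the sum of the three accuracy indicators minus 2, whose mean is
    at least [3 * 99 / 100 - 2]. *)
Lemma good_counting eta (ok : model_id -> R -> bool) :
  0 < eta ->
  (forall m, is_dist (cnt o m eta) /\ 99 / 100 <= prob (cnt o m eta) (ok m)
             /\ (S (cnt_cost o m eta) <= K)%nat) ->
  (forall z1 z2 z3, ok MNu z1 = true -> ok MMu z2 = true -> ok MAvg z3 = true ->
     Q (Halted (1 - z3 / sqrt (z1 * z2))) = true) ->
  forall rr nr, rr 1%nat = 1 -> rr 5%nat = eta -> good 8 (97 / 100) 95 rr nr.
Proof.
  intros Heta Hcnt HQ rr nr R1 R5.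
  set (ind m z := if ok m z then 1 else 0).
  assert (Hind : forall m, 99 / 100 <= ev (cnt o m eta) (ind m)).
  { intros m. destruct (Hcnt m) as [_ [Hp _]]. rewrite prob_ev in Hp. exact Hp. }
  assert (Hadd : forall m x, ev (cnt o m eta) (fun z => ind m z + x)
                  = ev (cnt o m eta) (ind m) + x).
  { intros m x. rewrite ev_plus, ev_const by apply Hcnt. reflexivity. }
  eapply good_mono with (j := 8%nat) (p := ev (cnt o MNu eta) (fun z1 => ev (cnt o MMu eta)
     (fun z2 => ev (cnt o MAvg eta) (fun z3 => ind MAvg z3 + (ind MMu z2 + (ind MNu z1 - 2))))));
    [|lia|].
  2:{ rewrite (ev_ext (cnt o MNu eta) _ (fun z1 => ind MNu z1
        + (ev (cnt o MAvg eta) (ind MAvg) + ev (cnt o MMu eta) (ind MMu) - 2))).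
      - rewrite Hadd. pose proof (Hind MNu). pose proof (Hind MMu). pose proof (Hind MAvg). lra.
      - intros pa _. rewrite (ev_ext (cnt o MMu eta) _ (fun z2 => ind MMu z2
          + (ev (cnt o MAvg eta) (ind MAvg) + (ind MNu (snd pa) - 2)))).
        + rewrite Hadd. ring.
        + intros pa' _. rewrite Hadd. ring. }
  rewrite <- R5.
  eapply good_count; [reflexivity|lra|rewrite R5; apply Hcnt|rewrite R5; apply Hcnt|].
  intros z1. cbn [updR Nat.eqb].
  assert (U1 : updR rr 6 z1 5 = eta) by (cbn; assumption).
  rewrite R5. rewrite <- U1 at 1.
  eapply good_count; [reflexivity|lra|rewrite U1; apply Hcnt|rewrite U1; apply Hcnt|].
  intros z2. 
  assert (U2 : updR (updR rr 6 z1) 7 z2 5 = eta) by (cbn; assumption).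
  rewrite <- U2.
  eapply good_count; [reflexivity|lra|rewrite U2; apply Hcnt|rewrite U2; apply Hcnt|].
  intros z3. do 4 step. rewrite R1. eapply good_halt; [reflexivity|lia|].
  cbn [updR Nat.eqb]. unfold ind.
  destruct (ok MNu z1) eqn:E1, (ok MMu z2) eqn:E2, (ok MAvg z3) eqn:E3;
    try (destruct (Q _); lra).
  rewrite HQ by assumption. lra.
Qed.

(** The three-way branch on [delta]. The case [delta = 0] is separate because a target of 0 must be
    returned exactly. *)
Lemma good_prelude eps j p
  (e := if Rlt_dec eps 1 then eps else 1) (delta := param_norm n dJ dh)
  (q := e / (INR (n + 1) * INR c)) (eta := q * q * (q * q)) :
  p <= 1 ->
  (delta <= 0 -> Q (Halted 0) = true) ->
  (0 < delta -> delta <= e / 8 -> forall rr nr,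
     loop_state eta 0 0 (1 / (eta * eta)) rr nr -> good j p 48 rr nr) ->
  (e / 8 < delta -> forall rr nr, rr 1%nat = 1 -> rr 5%nat = eta -> good j p 95 rr nr) ->
  forall rr, rr 0%nat = eps ->
  good (6 + (n * S (7 + (n * 9 + 4)) + (2 + (20 + j)))) p 0 rr (fun _ => 0%nat).
Proof.
  intros Hp H0 Hsamp Hcount rr R0.
  assert (Main : forall rr nr, nr 0%nat = n -> nr 1%nat = 1%nat -> rr 0%nat = e -> rr 1%nat = 1 ->
     rr 4%nat = delta -> good (20 + j) p 27 rr nr).
  { clear rr R0. intros rr nr N0 N1 R0 R1 R4. cbn [Nat.add].
    do 12 step. rewrite R0, R1, N0, N1.
    replace (1 - 1) with 0 by ring. replace (INR 8) with 8 by (simpl; lra).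
    fold q. fold eta. step. rewrite R4. destruct (Rlt_dec 0 delta) as [Hd|Hd].
    2:{ eapply good_halt; [reflexivity|lia|]. cbn [updR Nat.eqb]. rewrite H0; lra. }
    step. rewrite R4. destruct (Rlt_dec (e / 8) delta) as [He|He].
    - apply good_mono with (j := j) (p := p); [|lia|lra]. apply Hcount; auto.
    - do 6 step. apply Hsamp; [assumption|lra|]. rewrite R1, N0. unfold loop_state.
      cbn [updR updN Nat.eqb Nat.add]. repeat split; auto; lra. }
  cbn [Nat.add]. do 4 step. change (INR 1) with 1. rewrite R0.
  destruct (Rlt_dec eps 1) as [He|He].
  - assert (Ee : e = eps) by (unfold e; destruct (Rlt_dec eps 1); lra).
    apply good_mono with (p := p)
      (j := S (n * S (7 + (n * 9 + 4)) + (2 + (20 + j)))%nat); [|lia|lra].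
    step. apply good_param_norm with (e := e); auto; cbn; lra.
  - assert (Ee : e = 1) by (unfold e; destruct (Rlt_dec eps 1); lra).
    do 2 step. apply good_param_norm with (e := e); auto; cbn; lra.
Qed.

End Program.

(** * Correctness *)

Lemma exp_le_1_2x x : 0 <= x <= 1 / 2 -> exp x <= 1 + 2 * x.
Proof.
  intros Hx. pose proof (exp_ineq1_le (- x)).
  assert (E : exp x * exp (- x) = 1) by (rewrite <- exp_plus, <- exp_0; f_equal; ring).
  pose proof (exp_pos x) as Hp.
  assert (H1 : exp x * (1 - x) <= 1)
    by (rewrite <- E; apply Rmult_le_compat_l; lra).
  apply Rmult_le_reg_r with (1 - x); [lra|]. nra.
Qed.

Lemma withinP eps D r : exp (- eps) * D <= r <= exp eps * D ->
  within eps D (Halted r) = true.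
Proof.
  intros [H1 H2]. simpl. unfold Rleb.
  destruct (Rle_dec (exp (- eps) * D) r); [|contradiction].
  destruct (Rle_dec r (exp eps * D)); [reflexivity|contradiction].
Qed.

Lemma within_relative eps e D r : 0 < e <= 1 -> e <= eps -> 0 <= D ->
  Rabs (r - D) <= e / 2 * D -> within eps D (Halted r) = true.
Proof.
  intros He Hee HD Hr. apply withinP.
  assert (Hr' : D - e / 2 * D <= r <= D + e / 2 * D)
    by (revert Hr; unfold Rabs; destruct Rcase_abs; lra).
  pose proof (one_sub_exp_ge e ltac:(lra)).
  pose proof (exp_ineq1_le e).
  assert (exp (- eps) <= exp (- e)) by (apply exp_le_mono; lra).
  assert (exp e <= exp eps) by (apply exp_le_mono; lra).
  assert (exp (- eps) * D <= (1 - e / 2) * D) by (apply Rmult_le_compat_r; lra).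
  assert ((1 + e / 2) * D <= exp eps * D) by (apply Rmult_le_compat_r; lra).
  lra.
Qed.

(** Error budget: [4 * delta <= e / 2] covers the passage from [V] to [D], and the other [e / 2]
    absorbs the relative error [e / 4] of the estimate. *)
Lemma within_sampling eps e delta V D r : 0 < e <= 1 -> e <= eps -> 0 <= V ->
  delta <= e / 8 ->
  exp (- (4 * delta)) * V <= D <= exp (4 * delta) * V ->
  Rabs (r - V) <= e / 4 * V -> within eps D (Halted r) = true.
Proof.
  intros He Hee HV Hde [HD1 HD2] Hr. apply withinP.
  assert (Hr' : V - e / 4 * V <= r <= V + e / 4 * V)
    by (revert Hr; unfold Rabs; destruct Rcase_abs; lra).
  pose proof (exp_pos (4 * delta)). pose proof (exp_pos (- (4 * delta))).
  split.
  - pose proof (one_sub_exp_ge (e / 2) ltac:(lra)).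
    assert (exp (- eps) * exp (4 * delta) <= exp (- (e / 2)))
      by (rewrite <- exp_plus; apply exp_le_mono; lra).
    assert (exp (- eps) * D <= exp (- eps) * (exp (4 * delta) * V))
      by (apply Rmult_le_compat_l; [apply Rlt_le, exp_pos|assumption]).
    assert (exp (- eps) * exp (4 * delta) * V <= (1 - e / 4) * V)
      by (apply Rmult_le_compat_r; lra).
    lra.
  - pose proof (exp_ineq1_le (e / 4)).
    assert (exp (e / 2) <= exp eps * exp (- (4 * delta)))
      by (rewrite <- exp_plus; apply exp_le_mono; lra).
    assert (exp (e / 4) <= exp (e / 2)) by (apply exp_le_mono; lra).
    assert (exp eps * (exp (- (4 * delta)) * V) <= exp eps * D)
      by (apply Rmult_le_compat_l; [apply Rlt_le, exp_pos|assumption]).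
    assert ((1 + e / 4) * V <= exp eps * exp (- (4 * delta)) * V)
      by (apply Rmult_le_compat_r; lra).
    lra.
Qed.

(** A geometric mean averages the logarithmic errors, so the accuracy stays [eta]. *)
Lemma sqrt_prod_approx eta Z1 Z2 z1 z2 : 0 < Z1 -> 0 < Z2 ->
  exp (- eta) * Z1 <= z1 <= exp eta * Z1 -> exp (- eta) * Z2 <= z2 <= exp eta * Z2 ->
  exp (- eta) * sqrt (Z1 * Z2) <= sqrt (z1 * z2) <= exp eta * sqrt (Z1 * Z2).
Proof.
  intros P1 P2 [A1 B1] [A2 B2].
  pose proof (exp_pos eta). pose proof (exp_pos (- eta)).
  assert (Hs : forall x, exp x * sqrt (Z1 * Z2) = sqrt ((exp x * Z1) * (exp x * Z2))).
  { intros x. pose proof (exp_pos x).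
    replace ((exp x * Z1) * (exp x * Z2)) with ((exp x * exp x) * (Z1 * Z2)) by ring.
    rewrite (sqrt_mult (exp x * exp x)) by nra. rewrite sqrt_square by lra. reflexivity. }
  assert (0 < exp (- eta) * Z1) by (apply Rmult_lt_0_compat; assumption).
  assert (0 < exp (- eta) * Z2) by (apply Rmult_lt_0_compat; assumption).
  rewrite !Hs. split; apply sqrt_le_1_alt; apply Rmult_le_compat; lra.
Qed.

(** The ratio [rho] is known up to [exp (2 * eta)] and is at most 1, so the additive error is at
    most [4 * eta], hence at most [e / 2 * D]. *)
Lemma within_counting eps e eta Z1 Z2 Z3 z1 z2 z3 (D := 1 - Z3 / sqrt (Z1 * Z2)) :
  0 < e <= 1 -> e <= eps -> 0 < eta -> 0 < Z1 -> 0 < Z2 -> 0 < Z3 ->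
  0 <= D -> 8 * eta <= e * D ->
  exp (- eta) * Z1 <= z1 <= exp eta * Z1 -> exp (- eta) * Z2 <= z2 <= exp eta * Z2 ->
  exp (- eta) * Z3 <= z3 <= exp eta * Z3 ->
  within eps D (Halted (1 - z3 / sqrt (z1 * z2))) = true.
Proof.
  intros He Hee Heta P1 P2 P3 HD HeD H1 H2 [A3 B3].
  destruct (sqrt_prod_approx eta Z1 Z2 z1 z2 P1 P2 H1 H2) as [A B].
  assert (PS : 0 < sqrt (Z1 * Z2)) by (apply sqrt_lt_R0, Rmult_lt_0_compat; assumption).
  set (S := sqrt (Z1 * Z2)) in *. set (s := sqrt (z1 * z2)) in *.
  set (rho := Z3 / S). assert (Hrho : 0 < rho) by (apply Rdiv_lt_0_compat; assumption).
  assert (HDrho : D = 1 - rho) by reflexivity.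
  assert (HZ3 : Z3 = rho * S) by (unfold rho; field; lra).
  clearbody rho.
  assert (E1 : exp eta * exp (- eta) = 1) by (rewrite <- exp_plus, <- exp_0; f_equal; ring).
  pose proof (exp_pos eta). pose proof (exp_pos (- eta)).
  assert (Ps : 0 < s).
  { assert (0 < exp (- eta) * S) by (apply Rmult_lt_0_compat; assumption). lra. }
  assert (E2 : exp (- (2 * eta)) = exp (- eta) * exp (- eta))
    by (rewrite <- exp_plus; f_equal; ring).
  assert (E3 : exp (2 * eta) = exp eta * exp eta)
    by (rewrite <- exp_plus; f_equal; ring).
  assert (Hlo : exp (- (2 * eta)) * rho <= z3 / s).
  { apply Rmult_le_reg_r with s; [assumption|].
    replace (z3 / s * s) with z3 by (field; lra).
    apply Rle_trans with (exp (- (2 * eta)) * rho * (exp eta * S)).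
    - apply Rmult_le_compat_l; [|assumption]. rewrite E2.
      apply Rlt_le; repeat apply Rmult_lt_0_compat; assumption.
    - eapply Rle_trans; [|exact A3]. right. rewrite E2, HZ3.
      transitivity (exp (- eta) * (rho * S) * (exp eta * exp (- eta))); [ring|].
      rewrite E1; ring. }
  assert (Hup : z3 / s <= exp (2 * eta) * rho).
  { apply Rmult_le_reg_r with s; [assumption|].
    replace (z3 / s * s) with z3 by (field; lra).
    apply Rle_trans with (exp (2 * eta) * rho * (exp (- eta) * S)).
    - eapply Rle_trans; [exact B3|]. right. rewrite E3, HZ3.
      transitivity (exp eta * (rho * S) * (exp eta * exp (- eta))); [|ring].
      rewrite E1; ring.
    - apply Rmult_le_compat_l; [|assumption]. rewrite E3.
      apply Rlt_le; repeat apply Rmult_lt_0_compat; assumption. }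
  assert (Heta2 : 2 * eta <= 1 / 2) by nra.
  pose proof (exp_le_1_2x (2 * eta) ltac:(lra)).
  pose proof (exp_ineq1_le (- (2 * eta))).
  assert (exp (2 * eta) * rho <= (1 + 2 * (2 * eta)) * rho) by (apply Rmult_le_compat_r; lra).
  assert ((1 + - (2 * eta)) * rho <= exp (- (2 * eta)) * rho)
    by (apply Rmult_le_compat_r; lra).
  assert (eta * rho <= eta * 1) by (apply Rmult_le_compat_l; lra).
  apply within_relative with (e := e); try assumption.
  rewrite HDrho in *. unfold Rabs; destruct Rcase_abs; lra.
Qed.

Lemma exists_nat_ceil x : 0 < x -> exists M : nat, (1 <= M)%nat /\ x <= INR M < x + 1.
Proof.
  intros Hx. destruct (archimed x) as [H1 H2].
  assert (Hz : (0 < up x)%Z) by (apply lt_IZR; lra).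
  assert (HI : INR (Z.to_nat (up x)) = IZR (up x)) by (rewrite INR_IZR_INZ, Z2Nat.id by lia; reflexivity).
  destruct (Rlt_dec (IZR (up x)) (x + 1)).
  - exists (Z.to_nat (up x)). rewrite HI. split; [lia|lra].
  (* Here [up x = x + 1], so [x] is an integer and is its own ceiling. *)
  - exists (Z.to_nat (up x - 1)).
    assert (H1' : (1 < up x)%Z) by (apply lt_IZR; lra).
    assert (HI' : INR (Z.to_nat (up x - 1)) = IZR (up x) - 1)
      by (rewrite INR_IZR_INZ, Z2Nat.id, minus_IZR by lia; reflexivity).
    split; [lia|lra].
Qed.

Lemma hellinger_target_eq I :
  hellinger_target I = hellinger (inst_n I) (J_nu I) (h_nu I) (J_mu I) (h_mu I).
Proof. reflexivity. Qed.

Lemma pair_var_sub_sym n J h J' h' g :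
  pair_var n (fun u v => J' u v - J u v) (fun u => h' u - h u) g
  = pair_var n (fun u v => J u v - J' u v) (fun u => h u - h' u) g.
Proof.
  unfold pair_var. apply lsum_ext. intros s _. f_equal. apply lsum_ext. intros t _.
  rewrite <- !energy_sub. ring.
Qed.

Lemma param_norm_sub_sym n J h J' h' :
  param_norm n (fun u v => J' u v - J u v) (fun u => h' u - h u)
  = param_norm n (fun u v => J u v - J' u v) (fun u => h u - h' u).
Proof.
  unfold param_norm. apply rsum_ext. intros u _. rewrite Rabs_minus_sym. f_equal.
  apply rsum_ext. intros v _. apply Rabs_minus_sym.
Qed.

Lemma marginally_bounded_le n J h b b' :
  b' <= b -> marginally_bounded n J h b -> marginally_bounded n J h b'.
Proof. intros Hb H tau v c Hv Ht. specialize (H tau v c Hv Ht). lra. Qed.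

(** Here [2 ^ 24 = 64 ^ 4], and the left side is [e ^ 4 / B ^ 2]. The fourth power in [eta] matches
    [N ^ 4] in [hellinger_ge]. *)
Lemma oracle_accuracy_bound e N B (q := e / (N * (64 * B))) (eta := q * q * (q * q)) :
  0 < e <= 1 -> 1 <= N -> 1 <= B ->
  0 < eta /\ eta * (2 ^ 24 * (B ^ 2 * N ^ 4)) <= e ^ 3.
Proof.
  intros He HN HB.
  assert (Hq : 0 < q) by (apply Rdiv_lt_0_compat; nra).
  assert (Hqq : 0 < q * q) by (apply Rmult_lt_0_compat; exact Hq).
  split; [apply Rmult_lt_0_compat; exact Hqq|].
  replace (eta * (2 ^ 24 * (B ^ 2 * N ^ 4))) with (e ^ 3 * (e * / B ^ 2))
    by (unfold eta, q; field; lra).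
  rewrite <- (Rmult_1_r (e ^ 3)) at 2. apply Rmult_le_compat_l; [apply pow_le; lra|].
  assert (/ B ^ 2 <= 1) by (rewrite <- Rinv_1; apply Rinv_le_contravar; nra).
  assert (0 < / B ^ 2) by (apply Rinv_0_lt_compat; nra). nra.
Qed.

Section Correctness.

Variables (I : instance) (o : oracles) (B : nat) (Co : R) (ko : nat) (eps : R).
Hypothesis I_valid : valid_instance I.
Hypothesis B_ge1 : (1 <= B)%nat.
Hypothesis mu_bounded : marginally_bounded (inst_n I) (J_mu I) (h_mu I) (/ INR B).
Hypothesis o_ok : oracles_ok I Co ko o.
Hypothesis eps_pos : 0 < eps.

Let n := inst_n I.
Let dJ u v := J_nu I u v - J_mu I u v.
Let dh u := h_nu I u - h_mu I u.
Let delta := param_norm n dJ dh.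
Let D := hellinger_target I.
Let e := if Rlt_dec eps 1 then eps else 1.
Let q := e / (INR (n + 1) * INR (64 * B)).
Let eta := q * q * (q * q).
Let N := INR (n + 1).
(** The inverse polynomial factor of [hellinger_ge] at [b = / B]. *)
Let y := / (INR B ^ 2 * N ^ 4).

Lemma e_bounds : 0 < e <= 1 /\ e <= eps.
Proof. unfold e. destruct (Rlt_dec eps 1); lra. Qed.

Lemma N_ge1 : 1 <= N.
Proof. unfold N. rewrite plus_INR. pose proof (pos_INR n). simpl; lra. Qed.

Lemma INR_B_ge1 : 1 <= INR B.
Proof. change 1 with (INR 1). apply le_INR. assumption. Qed.

Lemma y_bounds : 0 < y <= 1.
Proof.
  pose proof N_ge1. pose proof INR_B_ge1.
  assert (1 <= INR B ^ 2) by (apply pow_R1_Rle; assumption).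
  assert (1 <= N ^ 4) by (apply pow_R1_Rle; assumption).
  assert (1 <= INR B ^ 2 * N ^ 4) by nra. unfold y. split.
  - apply Rinv_0_lt_compat; lra.
  - rewrite <- Rinv_1. apply Rinv_le_contravar; lra.
Qed.

Lemma eta_bounds : 0 < eta /\ 2 ^ 24 * eta <= e ^ 3 * y.
Proof.
  pose proof N_ge1 as HN. pose proof INR_B_ge1 as HB. pose proof e_bounds as [He _].
  destruct (oracle_accuracy_bound e N (INR B) He HN HB) as [H1 H2].
  assert (Eq : q = e / (N * (64 * INR B))).
  { unfold q, N. rewrite mult_INR. do 2 f_equal. f_equal. simpl; lra. }
  unfold eta. rewrite Eq. split; [exact H1|].
  assert (Hy : 0 < INR B ^ 2 * N ^ 4)
    by (apply Rmult_lt_0_compat; apply pow_lt; lra).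
  apply Rmult_le_reg_r with (INR B ^ 2 * N ^ 4); [assumption|].
  unfold y. rewrite Rmult_assoc, (Rmult_assoc (e ^ 3)), Rinv_l by lra. lra.
Qed.

Lemma eta_le_y : 2 ^ 24 * eta <= e * y.
Proof.
  pose proof eta_bounds as [_ H]. pose proof e_bounds as [He _]. pose proof y_bounds.
  assert (e ^ 3 * y <= e * y); [|lra].
  apply Rmult_le_compat_r; [lra|]. simpl. nra.
Qed.

Lemma delta_nonneg : 0 <= delta.
Proof.
  pose proof (energy_abs n dJ dh nil). pose proof (Rabs_pos (energy n dJ dh nil)).
  unfold delta. lra.
Qed.

Lemma target_ge m : 0 <= m <= 1 -> m <= delta -> m ^ 2 * y / 2048 <= D.
Proof.
  intros Hm Hmd. destruct I_valid as [HE [Hnu Hmu]].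
  (* The graph has no self-loops, so the couplings vanish on the diagonal. *)
  assert (Hdiag : forall J, ising_params_ok n (inst_edge I) J ->
            forall u, (u < n)%nat -> J u u = 0).
  { intros J HJ u Hu. destruct (HJ u u Hu Hu) as [_ H].
    destruct (Req_dec (J u u) 0) as [|Hne]; [assumption|].
    specialize (H Hne). destruct (HE u u Hu Hu) as [_ H']. congruence. }
  pose proof INR_B_ge1 as HB. pose proof N_ge1 as HN.
  replace (m ^ 2 * y / 2048) with ((/ INR B) ^ 2 * m ^ 2 / (2048 * (INR n + 1) ^ 4)).
  - unfold D. rewrite hellinger_target_eq.
    apply hellinger_ge; try assumption.
    + apply Rinv_0_lt_compat; lra.
    + rewrite <- Rinv_1. apply Rinv_le_contravar; lra.
    + intros; apply Hnu; assumption.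
    + intros; apply Hmu; assumption.
    + apply Hdiag, Hnu.
    + apply Hdiag, Hmu.
  - unfold y, N. rewrite plus_INR. simpl (INR 1).
    assert (INR n + 1 <> 0) by (pose proof (pos_INR n); lra). field. lra.
Qed.

Let m0 := if inst_flag I then MNu else MMu.
Let V := pair_var n dJ dh (gibbs_of I m0).

(** If the sampler is for [nu], the roles of the models are exchanged: the divergence is symmetric
    and the squared differences ignore the sign. *)
Lemma target_pair_var :
  exp (- (4 * delta)) * (V / 64) <= D <= exp (4 * delta) * (V / 64).
Proof.
  unfold V, m0, D. rewrite hellinger_target_eq. destruct (inst_flag I).
  - rewrite hellinger_sym. unfold delta, dJ, dh.
    rewrite <- pair_var_sub_sym, <- param_norm_sub_sym.
    apply (hellinger_pair_var n (J_mu I) (h_mu I) (J_nu I) (h_nu I)). reflexivity.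
  - apply (hellinger_pair_var n (J_nu I) (h_nu I) (J_mu I) (h_mu I)). reflexivity.
Qed.

Let W s t := (2 * (energy n dJ dh s - energy n dJ dh t)) ^ 2.

Lemma W_bounds s t : 0 <= W s t <= 16 * delta ^ 2.
Proof.
  split; [apply pow2_ge_0|]. unfold W.
  replace (16 * delta ^ 2) with ((4 * delta) ^ 2) by ring.
  apply pow_maj_Rabs. rewrite Rabs_mult, (Rabs_right 2) by lra.
  pose proof (energy_abs n dJ dh s). pose proof (energy_abs n dJ dh t).
  assert (Rabs (energy n dJ dh s - energy n dJ dh t)
          <= Rabs (energy n dJ dh s) + Rabs (energy n dJ dh t)).
  { unfold Rminus. rewrite <- (Rabs_Ropp (energy n dJ dh t)). apply Rabs_triang. }
  unfold delta. lra.
Qed.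

Lemma target_zero : delta <= 0 -> within eps D (Halted 0) = true.
Proof.
  intros H. pose proof delta_nonneg. assert (Hd : delta = 0) by lra.
  assert (HV : V = 0).
  { unfold V, pair_var. apply lsum_zero. intros s _.
    rewrite (lsum_zero _ (fun t => _ * _)); [ring|]. intros t _.
    pose proof (W_bounds s t) as HW. rewrite Hd in HW. unfold W in HW.
    replace ((2 * _) ^ 2) with 0 by lra. ring. }
  pose proof target_pair_var as HD. rewrite HV in HD.
  assert (HD0 : D = 0) by lra. rewrite HD0. apply withinP. lra.
Qed.

(** The sampler's bias contributes at most [e * V / 1024] and the fluctuation at most [e * V / 8],
    together below [e / 4 * V]. Both [V] and the bound on [W] scale as [delta ^ 2], so [M] can be
    chosen without regard to [delta]. *)
Lemma sampling_ok M rr nr K :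
  0 < delta -> delta <= e / 8 -> (2 * n + 50 <= K)%nat -> (S (samp_cost o eta) <= K)%nat ->
  (1 <= M)%nat -> 1 / (eta * eta) <= INR M < 1 / (eta * eta) + 1 ->
  loop_state I eta 0 0 (1 / (eta * eta)) rr nr ->
  good (hellinger_prog (64 * B)) I o (within eps D) K
    (M * (11 + n * S (12 + (n * 15 + 4))) + 7) (2 / 3) 48 rr nr.
Proof.
  intros Hd0 Hde HK Hcost HM1 HM HS.
  destruct eta_bounds as [Heta _]. pose proof eta_le_y as Hey.
  pose proof y_bounds as Hy. destruct e_bounds as [He Hee].
  destruct o_ok as [Hsamp _]. specialize (Hsamp eta Heta). cbv zeta in Hsamp.
  destruct Hsamp as [Hdist [Hlen [Htv _]]].
  assert (HMpos : 0 < INR M) by (apply lt_0_INR; lia).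
  set (w := ev (samp o eta) (fun s => ev (samp o eta) (W s))).
  assert (HVD : delta ^ 2 * y / 64 <= V).
  { pose proof (target_ge delta ltac:(lra) (Rle_refl _)).
    destruct target_pair_var as [_ Hup].
    assert (exp (4 * delta) <= 2) by (pose proof (exp_le_1_2x (4 * delta) ltac:(lra)); lra).
    assert (0 <= V).
    { apply lsum_nonneg. intros s _. apply Rmult_le_pos; [apply Rlt_le, gibbs_pos|].
      apply lsum_nonneg. intros t _. apply Rmult_le_pos; [apply Rlt_le, gibbs_pos|].
      apply pow2_ge_0. }
    assert (exp (4 * delta) * (V / 64) <= 2 * (V / 64)) by (apply Rmult_le_compat_r; lra).
    lra. }
  assert (Hd2 : 0 < delta ^ 2) by (apply pow_lt; assumption).
  assert (Hd2y : 0 < delta ^ 2 * y) by (apply Rmult_lt_0_compat; lra).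
  assert (HV : 0 < V) by lra.
  assert (HeV : 0 < e * V) by (apply Rmult_lt_0_compat; lra).
  assert (Hw : Rabs (w - V) <= e * V / 1024).
  { apply Rle_trans with (4 * eta * (16 * delta ^ 2)).
    - apply (ev2_tv n (samp o eta) (gibbs_of I m0) W); auto.
      + intros s. apply Rlt_le, gibbs_pos.
      + apply gibbs_sum.
      + nra.
      + intros s t. destruct (W_bounds s t). rewrite Rabs_right; lra.
    - assert (2 ^ 24 * eta * delta ^ 2 <= e * y * delta ^ 2)
        by (apply Rmult_le_compat_r; lra).
      assert (e * (delta ^ 2 * y) <= e * (64 * V)) by (apply Rmult_le_compat_l; lra).
      lra. }
  set (v := (16 * delta ^ 2) ^ 2).
  assert (Hv : ev (samp o eta) (fun s => ev (samp o eta) (fun t => W s t ^ 2)) <= v).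
  { rewrite <- (ev_const (samp o eta) v) by assumption. apply ev_le; [assumption|].
    intros [? s] _. cbn [snd]. rewrite <- (ev_const (samp o eta) v) by assumption.
    apply ev_le; [assumption|]. intros [? t] _. cbn [snd].
    apply pow_incr. apply W_bounds. }
  set (tau := INR M * (e * V / 8)).
  assert (Htau : 0 < tau) by (apply Rmult_lt_0_compat; lra).
  (* The centre is [M * w], the sampler's own mean, so the squared bias vanishes from Chebyshev's
     bound; [Hw] handles the bias separately. *)
  eapply good_mono; [eapply (good_sampling (64 * B) I o (within eps D) K HK eta M
    (1 / (eta * eta)) tau v (INR M * w)); try eassumption| lia|].
  - intros acc Hacc.
    assert (Hacc' : Rabs (acc - INR M * w) <= tau).
    { assert (Hs : Rsqr (acc - INR M * w) <= Rsqr tau) by (unfold Rsqr; lra).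
      apply Rsqr_le_abs_0 in Hs. rewrite (Rabs_right tau) in Hs by lra. exact Hs. }
    apply within_sampling with (e := e) (delta := delta) (V := V / 64); try assumption.
    + lra.
    + exact target_pair_var.
    + replace (acc / (INR M * 64) - V / 64)
        with (/ 64 * (/ INR M * (acc - INR M * w) + (w - V))) by (field; lra).
      rewrite Rabs_mult, (Rabs_right (/ 64)) by lra.
      assert (Rabs (/ INR M * (acc - INR M * w)) <= e * V / 8).
      { rewrite Rabs_mult, Rabs_right by (apply Rle_ge, Rlt_le, Rinv_0_lt_compat; assumption).
        apply Rmult_le_reg_l with (INR M); [assumption|].
        rewrite <- Rmult_assoc, Rinv_r by lra. fold tau. lra. }
      pose proof (Rabs_triang (/ INR M * (acc - INR M * w)) (w - V)). lra.
  - change (2 / 3 <= 1 - ((INR M * w - INR M * w) ^ 2 + INR M * v) / tau ^ 2).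
    replace (INR M * w - INR M * w) with 0 by ring.
    replace (0 ^ 2 + INR M * v) with (INR M * v) by ring.
    assert (Htau2 : 0 < tau ^ 2) by (apply pow_lt; assumption).
    assert (Hmain : INR M * v <= / 3 * tau ^ 2).
    { assert (HMe : 1 <= INR M * eta ^ 2).
      { assert (He2 : 0 < eta ^ 2) by (apply pow_lt; assumption).
        replace 1 with (1 / (eta * eta) * eta ^ 2) by (field; lra).
        apply Rmult_le_compat_r; lra. }
      assert (A1 : 2 ^ 24 * eta * delta ^ 2 <= 64 * (e * V)).
      { assert (2 ^ 24 * eta * delta ^ 2 <= e * y * delta ^ 2)
          by (apply Rmult_le_compat_r; lra).
        assert (e * (delta ^ 2 * y) <= e * (64 * V)) by (apply Rmult_le_compat_l; lra).
        lra. }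
      assert (A2 : (2 ^ 18 * (eta * delta ^ 2)) ^ 2 <= (e * V) ^ 2).
      { apply pow_incr. split; [|lra].
        apply Rmult_le_pos; [lra|]. apply Rmult_le_pos; lra. }
      assert (A3 : v <= INR M * eta ^ 2 * v).
      { rewrite <- (Rmult_1_l v) at 1. apply Rmult_le_compat_r; [apply pow2_ge_0|assumption]. }
      unfold tau.
      replace (/ 3 * (INR M * (e * V / 8)) ^ 2)
        with (INR M * (INR M * ((e * V) ^ 2 / 192))) by field.
      apply Rmult_le_compat_l; [lra|].
      eapply Rle_trans; [exact A3|]. rewrite Rmult_assoc.
      apply Rmult_le_compat_l; [lra|]. unfold v.
      replace (eta ^ 2 * (16 * delta ^ 2) ^ 2) with (256 * (eta * delta ^ 2) ^ 2) by ring.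
      rewrite Rpow_mult_distr in A2.
      pose proof (pow2_ge_0 (eta * delta ^ 2)). lra. }
    apply (Rmult_le_compat_r (/ tau ^ 2)) in Hmain;
      [|apply Rlt_le, Rinv_0_lt_compat; assumption].
    replace (/ 3 * tau ^ 2 * / tau ^ 2) with (/ 3) in Hmain by (field; lra).
    unfold Rdiv. lra.
Qed.

Lemma counting_ok rr nr K :
  e / 8 < delta -> (2 * n + 50 <= K)%nat ->
  (forall m, (S (cnt_cost o m eta) <= K)%nat) ->
  rr 1%nat = 1 -> rr 5%nat = eta ->
  good (hellinger_prog (64 * B)) I o (within eps D) K 8 (2 / 3) 95 rr nr.
Proof.
  intros Hde HK Hcost R1 R5.
  destruct eta_bounds as [Heta Hey]. pose proof y_bounds as Hy.
  destruct e_bounds as [He Hee]. destruct o_ok as [_ Hcnt].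
  apply good_mono with (j := 8%nat) (p := 97 / 100); [|lia|lra].
  apply (good_counting (64 * B) I o (within eps D) K HK eta
    (fun m z => Rleb (exp (- eta) * Z_of I m) z && Rleb z (exp eta * Z_of I m))); auto.
  - intros m. destruct (Hcnt m eta Heta) as [Hd [Hp _]].
    repeat split; auto; try apply Hd. lra.
  - assert (Hok : forall m z,
      Rleb (exp (- eta) * Z_of I m) z && Rleb z (exp eta * Z_of I m) = true ->
      exp (- eta) * Z_of I m <= z <= exp eta * Z_of I m).
    { intros m z H. apply andb_prop in H. revert H. unfold Rleb.
      destruct Rle_dec, Rle_dec; intros [? ?]; try discriminate. split; assumption. }
    intros z1 z2 z3 H1 H2 H3.
    apply Hok in H1. apply Hok in H2. apply Hok in H3.
    assert (HDZ : D = 1 - Z_of I MAvg / sqrt (Z_of I MNu * Z_of I MMu))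
      by (unfold D; rewrite hellinger_target_eq; apply hellinger_partition).
    rewrite HDZ.
    apply within_counting with (e := e) (eta := eta); try assumption;
      try apply partition_pos; rewrite <- HDZ.
    + apply hellinger_nonneg.
    (* Since [8 ^ 2 * 2048 = 2 ^ 17], [eta_bounds] yields [e * D >= 2 ^ 7 * eta], more than the
       required [8 * eta]. *)
    + pose proof (target_ge (e / 8) ltac:(lra) ltac:(lra)) as HD.
      apply (Rmult_le_compat_l e) in HD; [|lra].
      assert (0 < e ^ 3 * y) by (apply Rmult_lt_0_compat; [apply pow_lt|]; lra).
      replace (e * ((e / 8) ^ 2 * y / 2048)) with (e ^ 3 * y / 2 ^ 17) in HD by field.
      lra.
Qed.

End Correctness.

(** * Running time *)

(** Instructions on the path through the sampling branch; the 8 of the counting branch fit inside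
    when [M >= 1]. *)
Definition step_bound (n M : nat) : nat :=
  6 + (n * S (7 + (n * 9 + 4))
       + (2 + (20 + (M * (11 + n * S (12 + (n * 15 + 4))) + 7)))).

(** Coefficients are added after bounding each monomial in [n] by [X ^ 2]: [43 = 11 + 17 + 15] and
    [99 = 35 + 12 + 9 + 43]. *)
Lemma step_bound_poly n M X A : INR n <= X -> 1 <= X -> 0 <= A ->
  INR M <= A * X ^ 16 + 1 ->
  INR (step_bound n M) <= (99 + 43 * A) * X ^ 18.
Proof.
  intros Hn HX HA HM. pose proof (pos_INR n) as Pn. pose proof (pos_INR M) as PM.
  replace (INR (step_bound n M))
    with (35 + INR n * (12 + 9 * INR n) + INR M * (11 + INR n * (17 + 15 * INR n))).
  2:{ unfold step_bound. repeat (rewrite ?plus_INR, ?mult_INR, ?S_INR). simpl INR. ring. }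
  assert (HX2 : 1 <= X ^ 2) by (apply pow_R1_Rle; assumption).
  assert (HX16 : 1 <= X ^ 16) by (apply pow_R1_Rle; assumption).
  assert (HXX : X <= X ^ 2) by nra.
  assert (Hnn : INR n * INR n <= X ^ 2) by nra.
  assert (E : X ^ 18 = X ^ 16 * X ^ 2) by ring.
  assert (H1 : INR M * (11 + INR n * (17 + 15 * INR n)) <= (A * X ^ 16 + 1) * (43 * X ^ 2))
    by (apply Rmult_le_compat; [assumption|nra|assumption|nra]).
  assert (X ^ 2 <= X ^ 18) by (rewrite E; nra).
  nra.
Qed.

Lemma poly_time_le n C k eps T :
  INR n + / eps + 1 <= T -> 0 < eps -> 1 <= T -> poly_time n C k eps <= Rabs C * T ^ k.
Proof.
  intros HT He HT1. unfold poly_time.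
  assert (0 < / eps) by (apply Rinv_0_lt_compat; assumption). pose proof (pos_INR n).
  apply Rle_trans with (Rabs C * (INR n + / eps + 1) ^ k).
  - apply Rmult_le_compat_r; [apply pow_le; lra|apply Rle_abs].
  - apply Rmult_le_compat_l; [apply Rabs_pos|]. apply pow_incr. lra.
Qed.

(** The inverse of [eta] is [(c * (n + 1) / e) ^ 4], and both [n + 1] and [/ e] are at most [X]. *)
Lemma inv_oracle_accuracy_le eps n c X (e := if Rlt_dec eps 1 then eps else 1)
  (q := e / (INR (n + 1) * INR c)) (eta := q * q * (q * q)) :
  0 < eps -> (1 <= c)%nat -> X = INR n + / eps + 1 -> / eta <= INR c ^ 4 * X ^ 8.
Proof.
  intros He Hc HX. pose proof (pos_INR n) as Pn.
  assert (Hie : 0 < / eps) by (apply Rinv_0_lt_compat; assumption).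
  assert (Hc1 : 1 <= INR c) by (change 1 with (INR 1); apply le_INR; assumption).
  assert (He0 : 0 < e /\ / e <= X).
  { unfold e. destruct (Rlt_dec eps 1); split; try lra. }
  destruct He0 as [He0 HeX].
  assert (HN : INR (n + 1) = INR n + 1) by (rewrite plus_INR; reflexivity).
  assert (Hie0 : 0 < / e) by (apply Rinv_0_lt_compat; assumption).
  replace (/ eta) with ((INR c * (INR (n + 1) * / e)) ^ 4)
    by (unfold eta, q; field; rewrite HN; lra).
  replace (INR c ^ 4 * X ^ 8) with ((INR c * (X * X)) ^ 4) by ring.
  apply pow_incr. split.
  - apply Rmult_le_pos; [lra|]. apply Rmult_le_pos; [apply pos_INR|lra].
  - apply Rmult_le_compat_l; [lra|]. apply Rmult_le_compat; lra.
Qed.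

Theorem theorem1p9 :
  forall b : R, 0 < b ->
  exists P : list instr,
  forall (Co : R) (ko : nat),
  exists (Cp : R) (kp : nat),
  forall (I : instance) (o : oracles),
    valid_instance I ->
    marginally_bounded (inst_n I) (J_of I MNu) (h_of I MNu) b ->
    marginally_bounded (inst_n I) (J_of I MMu) (h_of I MMu) b ->
    oracles_ok I Co ko o ->
    forall (eps : R) (T : nat),
      0 < eps ->
      Cp * (INR (inst_n I) + / eps + 1) ^ kp <= INR T ->
      prob (run P I o eps T) is_timeout = 0
      /\ prob (run P I o eps T) (within eps (hellinger_target I)) >= 2 / 3.
Proof.
  intros b Hb.
  (* Rounding [/ b] up to an integer [B] lets the program hold the constant [64 * B], which depends
     on [b] alone. *)
  destruct (exists_nat_ceil (/ b) (Rinv_0_lt_compat _ Hb)) as [B [HB1 [HB _]]].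
  assert (HBb : / INR B <= b).
  { rewrite <- (Rinv_inv b). apply Rinv_le_contravar; [apply Rinv_0_lt_compat|]; assumption. }
  set (c := (64 * B)%nat). assert (Hc : (1 <= c)%nat) by (unfold c; lia).
  exists (hellinger_prog c). intros Co ko.
  set (A := INR c ^ 4).
  (* The first factor and the exponent 18 bound the number of instructions, the second factor and
     [8 * ko + 1] the cost of each. *)
  exists ((99 + 43 * A ^ 2) * (62 + 4 * (Rabs Co * (A + 1) ^ ko))), (18 + (8 * ko + 1))%nat.
  intros I o Hval _ Hmu Hok eps T Heps HT.
  set (n := inst_n I) in *. set (X := INR n + / eps + 1) in *.
  set (e := if Rlt_dec eps 1 then eps else 1).
  set (q := e / (INR (n + 1) * INR c)). set (eta := q * q * (q * q)).
  pose proof (inv_oracle_accuracy_le eps n c X Heps Hc eq_refl) as Hinv.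
  cbv zeta in Hinv. fold e q eta A in Hinv.
  assert (Hmu' : marginally_bounded (inst_n I) (J_mu I) (h_mu I) (/ INR B))
    by (apply marginally_bounded_le with b; assumption).
  assert (Heta : 0 < eta) by apply (eta_bounds I B eps HB1 Heps).
  assert (HX1 : 1 <= X).
  { unfold X. pose proof (pos_INR n). pose proof (Rinv_0_lt_compat _ Heps). lra. }
  assert (HA : 0 <= A) by (apply pow_le, pos_INR).
  assert (Hie : 0 < / eta) by (apply Rinv_0_lt_compat; assumption).
  assert (Hbound : 0 < 1 / (eta * eta)).
  { apply Rdiv_lt_0_compat; [lra|]. apply Rmult_lt_0_compat; assumption. }
  destruct (exists_nat_ceil _ Hbound) as [M [HM1 HM]].
  assert (HMX : INR M <= A ^ 2 * X ^ 16 + 1).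
  { apply Rlt_le. eapply Rlt_le_trans; [apply HM|]. apply Rplus_le_compat_r.
    replace (1 / (eta * eta)) with ((/ eta) ^ 2) by (field; lra).
    replace (A ^ 2 * X ^ 16) with ((A * X ^ 8) ^ 2) by ring.
    apply pow_incr; lra. }
  assert (HnX : INR n <= X) by (unfold X; pose proof (Rinv_0_lt_compat _ Heps); lra).
  (* Every oracle call uses the accuracy [eta], so one [K] dominates all instructions. *)
  set (K := (2 * n + 60 + samp_cost o eta + cnt_cost o MNu eta + cnt_cost o MMu eta
             + cnt_cost o MAvg eta)%nat).
  assert (HKX : INR K <= (62 + 4 * (Rabs Co * (A + 1) ^ ko)) * X ^ (8 * ko + 1)).
  { assert (HX8 : 1 <= X ^ 8) by (apply pow_R1_Rle; assumption).
    assert (HXX8 : X <= X ^ 8).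
    { replace (X ^ 8) with (X * X ^ 7) by ring.
      assert (1 <= X ^ 7) by (apply pow_R1_Rle; assumption). nra. }
    assert (Horacle : poly_time n Co ko eta
                      <= Rabs Co * (A + 1) ^ ko * X ^ (8 * ko + 1)).
    { assert (Hn1 : INR n + 1 <= X)
        by (unfold X; pose proof (Rinv_0_lt_compat _ Heps); lra).
      eapply Rle_trans; [apply (poly_time_le n Co ko eta ((A + 1) * X ^ 8))|].
      - lra.
      - assumption.
      - nra.
      - rewrite Rpow_mult_distr, <- pow_mult, <- Rmult_assoc.
        apply Rmult_le_compat_l.
        + apply Rmult_le_pos; [apply Rabs_pos|apply pow_le; lra].
        + apply Rle_pow; [assumption|lia]. }
    destruct Hok as [Hs Hcn]. specialize (Hs eta Heta). cbv zeta in Hs.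
    destruct Hs as [_ [_ [_ Hs]]].
    destruct (Hcn MNu eta Heta) as [_ [_ H1]]. destruct (Hcn MMu eta Heta) as [_ [_ H2]].
    destruct (Hcn MAvg eta Heta) as [_ [_ H3]]. fold n in Hs, H1, H2, H3.
    assert (X <= X ^ (8 * ko + 1)).
    { rewrite <- (pow_1 X) at 1. apply Rle_pow; [assumption|lia]. }
    unfold K. rewrite !plus_INR, mult_INR.
    replace (INR 2) with 2 by reflexivity. replace (INR 60) with 60 by (simpl; lra).
    lra. }
  assert (Hbudget : (step_bound n M * K <= T)%nat).
  { apply INR_le. rewrite mult_INR. eapply Rle_trans; [|exact HT].
    rewrite (pow_add X 18).
    pose proof (step_bound_poly n M X (A ^ 2) HnX HX1 (pow2_ge_0 A) HMX) as Hj.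
    apply Rle_trans with ((99 + 43 * A ^ 2) * X ^ 18
       * ((62 + 4 * (Rabs Co * (A + 1) ^ ko)) * X ^ (8 * ko + 1))).
    - apply Rmult_le_compat; auto using pos_INR.
    - right. ring. }
  assert (HK : (2 * n + 50 <= K)%nat) by (unfold K; lia).
  destruct (good_prelude c I o (within eps (hellinger_target I)) K HK eps
    (M * (11 + n * S (12 + (n * 15 + 4))) + 7) (2 / 3)
    ltac:(lra)) with (rr := fun i => if Nat.eqb i 0 then eps else 0) (fuel := T) (budget := T)
    as [H1 H2].
  - apply target_zero.
  - intros Hd0 Hde rr nr HS.
    apply (sampling_ok I o B Co ko eps Hval HB1 Hmu' Hok Heps M rr nr K); auto.
    unfold K, eta, q, e, n, c; lia.
  - intros Hde rr nr R1 R5. apply good_mono with (j := 8%nat) (p := 2 / 3); [|nia|lra].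
    apply (counting_ok I o B Co ko eps Hval HB1 Hmu' Hok Heps rr nr K); auto.
    intros m. change (S (cnt_cost o m eta) <= K)%nat. unfold K. destruct m; lia.
  - reflexivity.
  - exact Hbudget.
  - lia.
  - split; [exact H1|apply Rle_ge; exact H2].
Qed.
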